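(* Let $\theta$ be a constant with $0<\theta<\pi/2$, and let $$g = \frac{1}{q(x,y)^2}\left(\frac{dx^2}{A(x)}+\frac{dy^2}{B(y)}+A(x)\,ds^2+B(y)\,dt^2+2\sqrt{A(x)B(y)}\,\cos\theta\,ds\,dt\right)$$ be the non-axisymmetric metric described in the context. Then $g$ is a Ricci soliton, with constant $\lambda$ in the Ricci soliton equation $\mathrm{Ric}(g)+\frac12\mathcal{L}_V g=\lambda g$, if and only if $A$ and $B$ are constants and there are functions $S^x(x,y)$ and $S^y(x,y)$ satisfying the system of equations $$\partial_y S^x+\partial_x S^y=4q_xq_y,\qquad \partial_x S^x=2q_x^2,\qquad \partial_y S^y=2q_y^2,$$ $$\lambda=q_{xx}A+q_{yy}B-\frac{q_x^2A+q_y^2B}{q}-\frac{S^xq_xA+S^yq_yB}{q^2}.$$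
   Context: Setting: $U\subset\mathbb{R}^2$ is a nonempty connected open set with coordinates $(x,y)$; $T^2=\mathbb{R}^2/\Gamma$ is a torus ($\Gamma$ a lattice) with periodic coordinates $(s,t)$ (the torus fibers); $q=q(x,y)$ is a smooth nowhere-zero function on $U$; $A=A(x)$ is a smooth positive function of $x$ alone and $B=B(y)$ is a smooth positive function of $y$ alone. The metric $g$ is a Riemannian metric on the four-manifold $U\times T^2$. It is called non-axisymmetric because $\theta$ is a constant in $(0,\pi/2)$; $\theta=\pi/2$ would be the axisymmetric case, in which the coordinates $(s,t)$ on the torus fibers are orthogonal. Subscripts on $q$ denote partial derivatives, e.g. $q_x=\partial_x q$, $q_{xx}=\partial_x^2 q$, and function arguments are omitted. The superscripts in $S^x,S^y$ are only labels; $S^x,S^y$ are smooth functions on $U$. A metric $g$ is a Ricci soliton with constant $\lambda\in\mathbb{R}$ if there is a smooth vector field $V$ with $\mathrm{Ric}(g)+\frac12\mathcal{L}_V g=\lambda g$, where $\mathcal{L}_V$ is the Lie derivative.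
   Formalization: The last equation is corrected: its right-hand side is multiplied by q, i.e. λ = q(q_xx A + q_yy B − …). As printed the equivalence fails, e.g. for A = B = 1, q = y (hyperbolic metric, λ = −3). *)

(* Defs.v *)
From HB Require Import structures.
From mathcomp Require Import all_boot all_order all_algebra.
From mathcomp Require Import all_classical all_reals all_analysis.
Import numFieldNormedType.Exports.

Set Implicit Arguments.
Unset Strict Implicit.
Unset Printing Implicit Defensive.

Import Order.TTheory GRing.Theory Num.Theory.
Local Open Scope classical_set_scope.
Local Open Scope ring_scope.

Section Calculus.
Context {R : realType} {n : nat}.

Definition partial (i : 'I_n) (f : 'rV[R]_n -> R) : 'rV[R]_n -> R :=
  fun p => 'D_('e_i) f p.

(* All iterated partial derivatives are (Frechet) differentiable at the points
   of D. For D open this is C^oo: these derivatives are then continuous on D;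
   conversely, C^1 functions are differentiable. *)
Definition smooth_on (D : set 'rV[R]_n) (f : 'rV[R]_n -> R) : Prop :=
  forall (s : seq 'I_n) (p : 'rV[R]_n), D p -> differentiable (foldr partial f s) p.

End Calculus.

(* Tensor calculus in one coordinate chart: a (0,2)-tensor field is a
   matrix-valued function, a vector field a row-vector-valued function. *)
Section Tensors.
Context {R : realType} {n : nat}.
Implicit Types (g : 'rV[R]_n -> 'M[R]_n) (V : 'rV[R]_n -> 'rV[R]_n).

(* christoffel g k i j is Gamma^k_{ij} *)
Definition christoffel g (k i j : 'I_n) (p : 'rV[R]_n) : R :=
  2^-1 * \sum_l invmx (g p) k l *
    (partial i (fun x => g x j l) p + partial j (fun x => g x i l) p
     - partial l (fun x => g x i j) p).

(* Sign convention: the Ricci tensor of the round sphere is positive. *)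
Definition ricci g (p : 'rV[R]_n) : 'M[R]_n :=
  \matrix_(i, j)
    (\sum_k partial k (christoffel g k i j) p
     - \sum_k partial j (christoffel g k i k) p
     + \sum_k \sum_l christoffel g k k l p * christoffel g l i j p
     - \sum_k \sum_l christoffel g k j l p * christoffel g l i k p).

Definition lie_metric V g (p : 'rV[R]_n) : 'M[R]_n :=
  \matrix_(i, j)
    \sum_k (V p 0 k * partial k (fun x => g x i j) p
            + g p k j * partial i (fun x => V x 0 k) p
            + g p i k * partial j (fun x => V x 0 k) p).

End Tensors.

Section TorusBundle.
Context {R : realType}.

Definition is_lattice (Gamma : set 'rV[R]_2) : Prop :=
  exists2 b : 'M[R]_2, b \in unitmx &
    Gamma = [set v | exists m : 'rV[int]_2, v = map_mx intr m *m b].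

(* The 4-manifold U x R^2/Gamma is handled through its covering U x R^2, with
   coordinates (x, y) = lsubmx p and (s, t) = rsubmx p, numbered 0, 1, 2, 3. *)
Definition cover (U : set 'rV[R]_2) : set 'rV[R]_(2 + 2) :=
  [set p | U (lsubmx p)].

(* Smooth vector fields on U x R^2/Gamma, as Gamma-periodic ones on U x R^2;
   periodicity of the components is the right condition because the frame
   d/dx, d/dy, d/ds, d/dt is invariant under translations. *)
Definition smooth_vector_field (U Gamma : set 'rV[R]_2)
    (V : 'rV[R]_(2 + 2) -> 'rV[R]_(2 + 2)) : Prop :=
  (forall i, smooth_on (cover U) (fun p => V p 0 i)) /\
  (forall p v, cover U p -> Gamma v -> V (p + row_mx 0 v) = V p).

(* Ric(g) + 1/2 L_V g = lambda g; g is to be a (translation invariant, hence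
   Gamma-periodic) metric on the covering. *)
Definition ricci_soliton (U Gamma : set 'rV[R]_2)
    (g : 'rV[R]_(2 + 2) -> 'M[R]_(2 + 2)) (lambda : R) : Prop :=
  exists2 V, smooth_vector_field U Gamma V &
    forall p, cover U p ->
      ricci g p + 2^-1 *: lie_metric V g p = lambda *: g p.

(* The mixed term 2 sqrt(A B) cos theta ds dt contributes sqrt(A B) cos theta
   to each of the entries (s, t) and (t, s). *)
Definition torus_metric (theta : R) (A B : R -> R) (q : 'rV[R]_2 -> R)
    (p : 'rV[R]_(2 + 2)) : 'M[R]_(2 + 2) :=
  let z := lsubmx p in
  let a := A (z 0 0) in
  let b := B (z 0 1) in
  let c := Num.sqrt (a * b) * cos theta in
  (q z ^+ 2)^-1 *:
  \matrix_(i, j) nth 0 (nth [::]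
    [:: [:: a^-1; 0;    0; 0];
        [:: 0;    b^-1; 0; 0];
        [:: 0;    0;    a; c];
        [:: 0;    0;    c; b]] i) j.

(* The overall factor q z in the equation for lambda is forced by homogeneity:
   under q -> k q (k constant) one has lambda -> k^2 lambda, Sx -> k^2 Sx,
   Sy -> k^2 Sy. The source omits this factor, which makes its equivalence
   fail already for hyperbolic metrics (A = B = 1, q = y, lambda = -3). *)
Definition soliton_system (U : set 'rV[R]_2) (A B : R -> R)
    (q Sx Sy : 'rV[R]_2 -> R) (lambda : R) : Prop :=
  forall z, U z ->
  let qx := partial 0 q z in
  let qy := partial 1 q z in
  let qxx := partial 0 (partial 0 q) z in
  let qyy := partial 1 (partial 1 q) z in
  let a := A (z 0 0) in
  let b := B (z 0 1) in
  [/\ partial 1 Sx z + partial 0 Sy z = 4 * qx * qy,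
      partial 0 Sx z = 2 * qx ^+ 2,
      partial 1 Sy z = 2 * qy ^+ 2 &
      lambda = q z * (qxx * a + qyy * b
                      - (qx ^+ 2 * a + qy ^+ 2 * b) / q z
                      - (Sx z * qx * a + Sy z * qy * b) / q z ^+ 2)].

End TorusBundle.

(* Main.v *)
Require Import Defs.
From HB Require Import structures.
From mathcomp Require Import all_boot all_order all_algebra.
From mathcomp Require Import all_classical all_reals all_analysis.
From mathcomp Require Import ring lra.
Import numFieldNormedType.Exports.

Set Implicit Arguments.
Unset Strict Implicit.
Unset Printing Implicit Defensive.

Import Order.TTheory GRing.Theory Num.Theory.
Local Open Scope classical_set_scope.
Local Open Scope ring_scope.

(** Write g = h / q^2, where h is the metric with q = 1, put k = cos theta, and
    let r = sqrt (A B), so that g_ss, g_st, g_tt are A, r k, B over q^2.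

    Reduction to invariant fields. The metric and its Ricci tensor do not depend
    on (s, t), so the soliton equation is linear in the field V and its first
    derivatives with coefficients that are constant on the fibres. Hence it
    survives averaging V over the torus, done along one basis vector of the
    lattice after the other ([invariant_soliton_field]). Averages of smooth
    functions are smooth and averaging commutes with partial derivatives
    ([average_differentiable]); the average of a periodic function is invariant
    ([derive_average_periodic]). So V may be taken independent of (s, t).

    Rigidity. For an invariant field the Lie derivative of g in the fibre block
    is the directional derivative V(g_ab). Let T be the combination
    2 E_st / r - k (E_ss / A + E_tt / B) of the entries of a symmetric tensor E.
    It vanishes on g, because g_st is k times the geometric mean of g_ss and g_tt,
    and for the same reason it vanishes on V(g). On the Ricci tensor everything
    cancels except squares of first derivatives, and T is
    k (A'^2 / (4 A) + B'^2 / (4 B)) ([ricci_fibre_relation]). As k is not zero,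
    A' = B' = 0 ([invariant_soliton_constant]), and A and B are constant because
    U is connected. This is where the axisymmetric case k = 0 escapes.

    Constant profiles. Then h is flat, and the conformal change of a flat metric
    in dimension 4 gives Ric g = (2 / q) Hess q + (q Lap q - 3 |dq|^2) g, the
    Laplacian and the norm being those of h ([ricci_flat_conformal]). The fibre
    block of the soliton equation becomes
    lambda = q Lap q - 3 |dq|^2 - V(q) / q, and after substitution of this value
    the base block says that the symmetrised derivative of the 1-form V_i
    obtained from V by lowering the index with h is - 2 q Hess q. Since
    Hess (q^2) = 2 q Hess q + 2 dq dq, the 1-form S_i = V_i + 2 q d_i q has
    symmetrised derivative 2 dq dq: these are the equations for S^x and S^y, and
    the formula for lambda in terms of S is the fourth equation. All these steps
    can be reversed, starting from S and taking no component along the fibres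
    ([soliton_of_system]). *)

Local Notation cover := Defs.cover.

(** * Small increments and the mean value theorem *)

Section SmallIncrements.
Context {R : realType} {V : normedModType R}.
Implicit Types (f g : V -> R) (x v : V).

Lemma is_derive_along f x v (s : R) :
  derivable f (s *: v + x) v ->
  is_derive s 1 (fun t : R => f (t *: v + x)) ('D_v f (s *: v + x)).
Proof.
have E : (fun h : R => h^-1 *: (((fun t : R => f (t *: v + x)) \o shift s) (h *: 1)
           - f (s *: v + x))) =
     (fun h : R => h^-1 *: ((f \o shift (s *: v + x)) (h *: v) - f (s *: v + x))).
  by apply/funext => h /=; rewrite addrA -scalerDl [h *: 1]mulr1.
move=> df; apply: DeriveDef; first by rewrite /derivable E.
by rewrite /derive E.
Qed.

Lemma mean_value_along f x v :
  (forall s : R, 0 <= s <= 1 -> derivable f (s *: v + x) v) ->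
  exists2 s : R, 0 <= s <= 1 & f (v + x) - f x = 'D_v f (s *: v + x).
Proof.
move=> df; set phi := fun t : R => f (t *: v + x).
have dphi (s : R) : 0 <= s <= 1 -> is_derive s 1 phi ('D_v f (s *: v + x)).
  by move=> s01; apply: is_derive_along; exact: df.
have [||c c01 E] := @MVT R phi (fun s => 'D_v f (s *: v + x)) 0 1 ltr01.
- by move=> s /[!in_itv]/= /andP[s0 s1]; apply: dphi; rewrite !ltW.
- apply: derivable_within_continuous => s /[!in_itv]/= s01.
  by have [] := dphi s s01.
exists c; first by move: c01; rewrite in_itv/= => /andP[? ?]; rewrite !ltW.
by move: E; rewrite /phi scale1r scale0r add0r subr0 mulr1.
Qed.

(** The differential is zero. A general differentiability statement reduces to
    this one by subtracting the candidate linear part. *)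
Lemma small_increment_differentiable g x :
  (forall e : R, 0 < e -> \forall h \near 0, `|g (h + x) - g x| <= e * `|h|) ->
  differentiable g x /\ forall v, 'D_v g x = 0.
Proof.
move=> gx.
have go : g \o shift x = cst (g x) + (\0 : {linear V -> R}) +o_ 0 id.
  apply/eqaddoP => e e0; near=> h => /=.
  have -> : (g \o shift x - (cst (g x) + \0)) h = g (h + x) - g x.
    by rewrite !fctE /= addr0.
  by near: h; exact: gx.
have c0 : continuous (\0 : {linear V -> R}) by move=> ?; exact: cvg_cst.
have d0 := diff_unique c0 go.
have dg : differentiable g x.
  by apply/diff_locallyP; split; rewrite d0//; exact: c0.
by split=> // v; rewrite deriveE// d0.
Unshelve. all: by end_near. Qed.

End SmallIncrements.

Section PartialDerivatives.
Context {R : realType} {n : nat}.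
Implicit Types (D : set 'rV[R]_n) (f g : 'rV[R]_n -> R) (p v : 'rV[R]_n).

Lemma derive_partial f p v :
  differentiable f p -> 'D_v f p = \sum_i v 0 i * partial i f p.
Proof.
move=> df; rewrite deriveE// {1}(row_sum_delta v) linear_sum.
by apply: eq_bigr => i _; rewrite linearZ /= -deriveE.
Qed.

Lemma coord_le_norm p i : `|p 0 i| <= `|p|.
Proof.
by rewrite [leRHS]/Num.norm /= mx_normrE; apply/bigmax_geP; right; exists (0, i).
Qed.

(** Balls are convex, so what holds near p holds along all short segments that
    start near p. *)
Lemma near_segment p (P : 'rV[R]_n -> Prop) :
  (\forall z \near p, P z) ->
  \forall y \near p & h \near (0 : 'rV[R]_n),
    forall s : R, 0 <= s <= 1 -> P (s *: h + y).
Proof.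
move=> /nbhs_ballP[d /= d0 Pd].
exists (ball p (d / 2), ball 0 (d / 2)).
  by split; apply: nbhsx_ballx; rewrite divr_gt0.
move=> [y h] /= [yp h0] s /andP[s0 s1]; apply: Pd.
move: yp h0; rewrite -!ball_normE /= sub0r normrN => yp h0.
rewrite opprD addrCA (splitr d) addrC (le_lt_trans (ler_normD _ _))//.
rewrite ltrD// normrN normrZ ger0_norm//.
by rewrite (le_lt_trans _ h0)// ler_piMl.
Qed.

(** The base point y varies together with the increment h. This uniformity is
    what survives integration over a compact segment of base points. It comes from
    the mean value theorem along h, the partial derivatives being almost constant
    near p. *)
Lemma strictly_differentiable f p :
  (\forall y \near p, differentiable f y) ->
  (forall i, {for p, continuous (partial i f)}) ->
  forall e : R, 0 < e ->
  \forall y \near p & h \near (0 : 'rV[R]_n),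
    `|f (h + y) - f y - \sum_i h 0 i * partial i f y| <= e * `|h|.
Proof.
move=> df cf e e0.
pose c := e / n.+1%:R / 2.
have c0 : 0 < c by rewrite !divr_gt0.
have cfp : \forall z \near p,
    differentiable f z /\ forall i, `|partial i f p - partial i f z| <= c.
  near=> z; split; first by near: z.
  near: z; apply: filter_forall => i.
  by have /cvgr_dist_le := cf i; exact.
have := near_segment cfp.
apply: filterS => -[y h] /= seg.
have [s s01 ->] := @mean_value_along _ _ f y h (fun s s01 =>
  diff_derivable (seg s s01).1).
rewrite (derive_partial _ (seg s s01).1) -sumrB (le_trans (ler_norm_sum _ _ _))//.
have /seg : 0 <= (0 : R) <= 1 by rewrite lexx ler01.
rewrite scale0r add0r => -[_ y1]; have [_ y2] := seg s s01.
apply: (@le_trans _ _ (\sum_(i < n) `|h| * (e / n.+1%:R))).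
  apply: ler_sum => i _; rewrite -mulrBr normrM ler_pM ?coord_le_norm//.
  rewrite (_ : _ - _ = (partial i f p - partial i f y) -
     (partial i f p - partial i f (s *: h + y))); last by ring.
  rewrite (le_trans (ler_normB _ _))// (le_trans (lerD (y1 i) (y2 i)))//.
  by rewrite -splitr.
rewrite sumr_const card_ord -[leLHS]mulr_natr [leRHS]mulrC -mulrA.
rewrite ler_wpM2l//.
by rewrite mulrAC ler_pdivrMr// ler_pM2l// ler_nat.
Unshelve. all: by end_near. Qed.

End PartialDerivatives.

(** * Smooth functions *)

Lemma dist_le_common {R : realType} (u w x e : R) :
  `|u - x| <= e / 2 -> `|w - x| <= e / 2 -> `|u - w| <= e.
Proof.
move=> ux wx; rewrite -(subrKA x) (le_trans (ler_normD _ _))// (splitr e) lerD//.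
by rewrite distrC.
Qed.

Section Smoothness.
Context {R : realType} {n : nat}.
Implicit Types (D : set 'rV[R]_n) (f g : 'rV[R]_n -> R) (p : 'rV[R]_n).

Lemma near_in_open D (Q : 'rV[R]_n -> Prop) p :
  open D -> (forall z, D z -> Q z) -> D p -> \forall z \near p, Q z.
Proof. by move=> oD DQ Dp; apply: filterS DQ _; exact: open_nbhs_nbhs. Qed.

Lemma eq_on_derive D f g p v : open D -> (forall z, D z -> f z = g z) ->
  D p -> 'D_v f p = 'D_v g p.
Proof. by move=> oD fg Dp; apply: near_eq_derive; exact: (near_in_open oD fg Dp). Qed.

(** The difference g - f vanishes near p, so it has small increments. *)
Lemma eq_on_differentiable D f g p : open D -> (forall z, D z -> f z = g z) ->
  D p -> differentiable f p -> differentiable g p.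
Proof.
move=> oD fg Dp df.
have -> : g = f + (g - f) by apply/funext => z; rewrite !fctE addrC subrK.
apply: differentiableD => //.
apply: (small_increment_differentiable _).1 => e e0.
have D0 : \forall h \near (0 : 'rV[R]_n), D (h + p).
  rewrite (near_shift p) sub0r; near=> z => /=; rewrite subrK.
  by near: z; exact: open_nbhs_nbhs.
apply: filterS D0 => h Dh; rewrite !fctE !fg// !subrr normr0.
by rewrite mulr_ge0// ltW.
Unshelve. all: by end_near. Qed.

Lemma eq_on_foldr_partial D f g s p : open D -> (forall z, D z -> f z = g z) ->
  D p -> foldr partial f s p = foldr partial g s p.
Proof.
by move=> oD fg; elim: s p => [|i s IH] p Dp //=; [exact: fg|exact: (eq_on_derive _ oD IH Dp)].
Qed.

(** Coinduction, which replaces Leibniz formulas for iterated derivatives: if a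
    class consists of functions differentiable on D and contains, up to equality
    on D, the partial derivatives of its members, then its members are smooth. *)
Lemma smooth_on_coind D (P : ('rV[R]_n -> R) -> Prop) : open D ->
  (forall f, P f -> (forall p, D p -> differentiable f p) /\
     forall i, exists2 g, P g & forall p, D p -> partial i f p = g p) ->
  forall f, P f -> smooth_on D f.
Proof.
move=> oD stepP f Pf s.
elim/last_ind: s f Pf => [|s i IH] f Pf p Dp /=; first exact: (stepP f Pf).1.
have [g Pg fg] := (stepP f Pf).2 i.
rewrite foldr_rcons; apply: (eq_on_differentiable oD _ Dp (IH g Pg p Dp)) => z Dz.
by symmetry; exact: (eq_on_foldr_partial s oD fg Dz).
Qed.

Lemma smooth_on_differentiable D f p :
  smooth_on D f -> D p -> differentiable f p.
Proof. by move=> sf Dp; exact: (sf [::]). Qed.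

Lemma smooth_on_partial D f i : smooth_on D f -> smooth_on D (partial i f).
Proof. by move=> sf s p Dp; rewrite -foldr_rcons; exact: sf. Qed.

Lemma smooth_on_continuous D f p : smooth_on D f -> D p -> {for p, continuous f}.
Proof. by move=> sf /(smooth_on_differentiable sf)/differentiable_continuous. Qed.

Lemma partialD f g i p : differentiable f p -> differentiable g p ->
  partial i (f + g) p = partial i f p + partial i g p.
Proof. by move=> df dg; apply: deriveD; exact: diff_derivable. Qed.

Lemma partialM f g i p : differentiable f p -> differentiable g p ->
  partial i (f * g) p = f p * partial i g p + g p * partial i f p.
Proof. by move=> df dg; apply: deriveM; exact: diff_derivable. Qed.

(** The Leibniz rule turns a product into a sum of products, so sums have to be
    included for the class to be closed under partial derivatives. *)
Inductive smooth_poly D : ('rV[R]_n -> R) -> Prop :=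
| smooth_poly_base f of smooth_on D f : smooth_poly D f
| smooth_polyD f g of smooth_poly D f & smooth_poly D g : smooth_poly D (f + g)
| smooth_polyM f g of smooth_poly D f & smooth_poly D g : smooth_poly D (f * g).

Lemma smooth_poly_smooth_on D f : open D -> smooth_poly D f -> smooth_on D f.
Proof.
move=> oD; apply: (smooth_on_coind oD) => {}f.
have dP h : smooth_poly D h -> forall p, D p -> differentiable h p.
  elim=> {}h; first by move=> sh p; exact: smooth_on_differentiable.
    by move=> g _ dh _ dg p Dp; apply: differentiableD; [exact: dh|exact: dg].
  by move=> g _ dh _ dg p Dp; apply: differentiableM; [exact: dh|exact: dg].
move=> Pf; split; first exact: dP.
move=> i; elim: Pf => {}f.
- by move=> sf; exists (partial i f) => //; constructor 1; exact: smooth_on_partial.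
- move=> g Pf [f' Pf' ff'] Pg [g' Pg' gg'].
  exists (f' + g'); first by constructor 2.
  by move=> p Dp; rewrite partialD ?ff' ?gg'//; exact: dP.
- move=> g Pf [f' Pf' ff'] Pg [g' Pg' gg'].
  exists (f * g' + g * f'); first by constructor 2; constructor 3.
  by move=> p Dp; rewrite partialM ?ff' ?gg'//; exact: dP.
Qed.

Lemma smooth_onD D f g : open D ->
  smooth_on D f -> smooth_on D g -> smooth_on D (f + g).
Proof.
by move=> oD sf sg; apply: smooth_poly_smooth_on => //; constructor 2; constructor 1.
Qed.

Lemma smooth_onM D f g : open D ->
  smooth_on D f -> smooth_on D g -> smooth_on D (f * g).
Proof.
by move=> oD sf sg; apply: smooth_poly_smooth_on => //; constructor 3; constructor 1.
Qed.

Lemma partial_cst (a : R) i : partial i (cst a : 'rV[R]_n -> R) = cst 0.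
Proof. by apply/funext => p; exact: derive_cst. Qed.

Lemma smooth_on_cst D (a : R) : smooth_on D (cst a).
Proof.
move=> s p Dp; suff [b ->] : exists b, foldr partial (cst a) s = cst b.
  exact: differentiable_cst.
by elim: s => [|i s [b /= ->]]; [exists a|exists 0; exact: partial_cst].
Qed.

Lemma derive_scale f p v (t : R) :
  differentiable f p -> 'D_(t *: v) f p = t * 'D_v f p.
Proof. by move=> df; rewrite !deriveE// linearZ. Qed.

Lemma derive_comp_shift f v w p :
  'D_v (f \o shift w) p = 'D_v f (p + w).
Proof. by rewrite /derive /=; under eq_fun do rewrite -addrA. Qed.

(** The mean value theorem, applied first along 'e_i to the increment of f in the
    direction 'e_j, then along 'e_j to partial i f. *)
Lemma second_difference f i j p (t : R) :
  (forall a b : R, 0 <= a <= 1 -> 0 <= b <= 1 ->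
     let z := b *: (t *: 'e_j) + (a *: (t *: 'e_i) + p) in
     differentiable f z /\ differentiable (partial i f) z) ->
  exists a b : R, [/\ 0 <= a <= 1, 0 <= b <= 1 &
    f (t *: 'e_j + (t *: 'e_i + p)) - f (t *: 'e_i + p)
      - (f (t *: 'e_j + p) - f p) =
    t ^+ 2 * partial j (partial i f) (b *: (t *: 'e_j) + (a *: (t *: 'e_i) + p))].
Proof.
move=> df; pose F := (f \o shift (t *: 'e_j)) - f.
have i01 : 0 <= (1 : R) <= 1 by rewrite ler01 lexx.
have i00 : 0 <= (0 : R) <= 1 by rewrite ler01 lexx.
have dfs (a : R) : 0 <= a <= 1 ->
    differentiable (f \o shift (t *: 'e_j)) (a *: (t *: 'e_i) + p).
  move=> a01; apply: differentiable_comp => //=.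
  by have [] := df a 1 a01 i01; rewrite scale1r addrC.
have df0 (a : R) : 0 <= a <= 1 -> differentiable f (a *: (t *: 'e_i) + p).
  by move=> a01; have [] := df a 0 a01 i00; rewrite scale0r add0r.
have dF (a : R) : 0 <= a <= 1 -> differentiable F (a *: (t *: 'e_i) + p).
  by move=> a01; apply: differentiableB; [exact: dfs|exact: df0].
have [a a01] := mean_value_along (fun a a01 => diff_derivable (dF a a01)).
rewrite derive_scale; last exact: dF.
rewrite deriveB; [|exact/diff_derivable/dfs|exact/diff_derivable/df0].
rewrite derive_comp_shift.
rewrite -/(partial i f _) -/(partial i f _) /F !fctE /= => E.
have dp (b : R) : 0 <= b <= 1 ->
    differentiable (partial i f) (b *: (t *: 'e_j) + (a *: (t *: 'e_i) + p)).
  by move=> b01; have [] := df a b a01 b01.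
have [b b01 E'] := mean_value_along (fun b b01 => diff_derivable (dp b b01)).
exists a, b; split=> //.
rewrite (derive_scale _ _ (dp b b01)) in E'.
rewrite expr2 -mulrA -[partial j _ _]/('D_('e_j) (partial i f) _) -E'.
by rewrite !(addrC (t *: 'e_j)) -E.
Qed.

(** The second difference is symmetric in i and j, and divided by t^2 it is close
    to either mixed derivative, both of which are continuous at p. *)
Lemma schwarz D f i j p : open D -> smooth_on D f -> D p ->
  partial i (partial j f) p = partial j (partial i f) p.
Proof.
move=> oD sf Dp.
have c k l : {for p, continuous (partial k (partial l f))}.
  by apply: smooth_on_continuous Dp; do 2 apply: smooth_on_partial.
have : forall e : R, 0 < e ->
    `|partial i (partial j f) p - partial j (partial i f) p| <= e.
  move=> e e0; have e20 : 0 < e / 2 by rewrite divr_gt0.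
  have : \forall z \near p, [/\ D z,
      `|partial i (partial j f) p - partial i (partial j f) z| <= e / 2 &
      `|partial j (partial i f) p - partial j (partial i f) z| <= e / 2].
    have nD : \forall z \near p, D z by exact: open_nbhs_nbhs.
    have nc k l : \forall z \near p,
        `|partial k (partial l f) p - partial k (partial l f) z| <= e / 2.
      by have /cvgr_dist_le := c k l; exact.
    by apply: filterS3 nD (nc i j) (nc j i) => z; split.
  move=> /nbhs_ballP[d /= d0 pd].
  pose M : R := `|'e_i : 'rV[R]_n| + `|'e_j : 'rV[R]_n| + 1.
  have M0 : 0 < M by rewrite ltr_pwDr// addr_ge0.
  (* with this step all the points at which a mean value is taken lie in the ball *)
  have [t t0 tM] : exists2 t : R, 0 < t & t * M = d.
    by exists (d / M); rewrite ?divr_gt0// divfK// lt0r_neq0.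
  have bt (k l : 'I_n) (a b : R) : M = `|'e_k : 'rV[R]_n| + `|'e_l : 'rV[R]_n| + 1 ->
      0 <= a <= 1 -> 0 <= b <= 1 -> ball p d (b *: (t *: 'e_l) + (a *: (t *: 'e_k) + p)).
    move=> ME /andP[a0 a1] /andP[b0 b1].
    rewrite -ball_normE /= distrC addrA addrK (le_lt_trans (ler_normD _ _))//.
    rewrite !normrZ !(ger0_norm a0, ger0_norm b0, gtr0_norm t0).
    rewrite (@le_lt_trans _ _ (t * (`|'e_k : 'rV[R]_n| + `|'e_l : 'rV[R]_n|)))//.
      by rewrite mulrDr addrC; apply: lerD; apply: ler_piMl => //; rewrite mulr_ge0// ltW.
    by rewrite -tM ltr_pM2l// ME ltrDl.
  have ME : M = `|'e_j : 'rV[R]_n| + `|'e_i : 'rV[R]_n| + 1.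
    by rewrite /M [X in X + 1]addrC.
  have [a b a01 b01|a [b [a01 b01 Eij]]] := @second_difference f i j p t.
    have [Dz _ _] := pd _ (bt i j a b erefl a01 b01).
    by split; apply: smooth_on_differentiable Dz => //; exact: smooth_on_partial.
  have [a' b' a01' b01'|a' [b' [a01' b01' Eji]]] := @second_difference f j i p t.
    have [Dz _ _] := pd _ (bt j i a' b' ME a01' b01').
    by split; apply: smooth_on_differentiable Dz => //; exact: smooth_on_partial.
  have E : partial j (partial i f) (b *: (t *: 'e_j) + (a *: (t *: 'e_i) + p)) =
      partial i (partial j f) (b' *: (t *: 'e_i) + (a' *: (t *: 'e_j) + p)).
    apply: (mulfI (lt0r_neq0 (exprn_gt0 2 t0))).
    apply: etrans (esym Eij) (etrans _ Eji).
    rewrite (addrCA (t *: 'e_i) (t *: 'e_j)).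
    move: (f (_ + (_ + _))) (f (t *: 'e_i + p)) (f (t *: 'e_j + p)) => u v w; ring.
  have [_ _] := pd _ (bt i j a b erefl a01 b01).
  have [_ + _] := pd _ (bt j i a' b' ME a01' b01').
  rewrite E => h1 h2; exact: (dist_le_common h1 h2).
move=> small; apply/eqP; rewrite -subr_eq0 -normr_le0; apply/ler_addgt0Pr => e e0.
by rewrite add0r; exact: small.
Unshelve. all: by end_near. Qed.

End Smoothness.

(** * Functions on the base and on the covering *)

Section Reparametrization.
Context {R : realType} {V W : normedModType R}.

(** A directional derivative only sees the restriction to a line. Coordinates,
    the projection to the base and the zero section are affine on lines, so no
    chain rule is needed for them. *)
Lemma eq_along_derive (f : V -> R) (g : W -> R) p v p' v' :
  (forall h : R, f (h *: v + p) = g (h *: v' + p')) -> 'D_v f p = 'D_v' g p'.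
Proof.
move=> fg; have := fg 0; rewrite !scale0r !add0r => fg0.
by rewrite /derive fg0 /=; under eq_fun do rewrite fg.
Qed.

End Reparametrization.

Section Coordinates.
Context {R : realType}.

Lemma partial_coord n (F : R -> R) (i : 'I_n) (z : 'rV[R]_n) :
  partial i (fun z => F (z 0 i)) z = derive1 F (z 0 i).
Proof.
rewrite derive1E; apply: eq_along_derive => h.
by rewrite !mxE !eqxx.
Qed.

Lemma partial_other_coord n (F : R -> R) (i j : 'I_n) (z : 'rV[R]_n) :
  i != j -> partial i (fun z => F (z 0 j)) z = 0.
Proof.
move=> ij; rewrite /partial -(derive_cst (F (z 0 j)) z ('e_i)).
by apply: eq_along_derive => h; rewrite !mxE eq_sym (negbTE ij) /= mulr0 add0r.
Qed.

(** The level sets of f are open by the mean value theorem on balls, hence also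
    relatively closed. *)
Lemma locally_constant_on n (U : set 'rV[R]_n) (f : 'rV[R]_n -> R) :
  open U -> connected U -> (forall z, U z -> differentiable f z) ->
  (forall i z, U z -> partial i f z = 0) ->
  forall z z', U z -> U z' -> f z = f z'.
Proof.
move=> oU cU df f0 z z' Uz Uz'.
have loc y : U y -> \forall x \near y, U x /\ f x = f y.
  move=> Uy; have : nbhs y U by exact: open_nbhs_nbhs.
  move=> /nbhs_ballP[d /= d0 yU].
  apply/nbhs_ballP; exists d => // x xy; split; first exact: yU.
  have seg (s : R) : 0 <= s <= 1 -> U (s *: (x - y) + y).
    move=> /andP[s0 s1]; apply: yU; move: xy.
    rewrite -!ball_normE /= opprD addrCA subrr addr0 normrN distrC => xy.
    by rewrite normrZ ger0_norm// (le_lt_trans _ xy)// ler_piMl.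
  have [s s01] := mean_value_along (fun s s01 => diff_derivable (df _ (seg s s01))).
  rewrite subrK derive_partial; last exact/df/seg.
  rewrite big1 => [/eqP|i _]; first by rewrite subr_eq0 => /eqP.
  by rewrite f0 ?mulr0//; exact: seg.
have UE : U `&` [set y | f y = f z'] = U.
  apply: cU; first by exists z'.
  - exists (U `&` [set y | f y = f z']); last by rewrite setIA setIid.
    rewrite openE => y [Uy fy]; apply: filterS (loc y Uy) => x [Ux fx].
    by split => //=; rewrite fx.
  - exists (~` (U `&` [set y | f y != f z'])).
      rewrite closedC openE => y [Uy fy]; apply: filterS (loc y Uy) => x [Ux fx].
      by split => //=; rewrite fx.
    apply/seteqP; split=> y [Uy /= fy]; split=> //.
      by move=> [_ /=]; rewrite fy eqxx.
    by apply/eqP; apply: contra_notT fy.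
by have [] : (U `&` [set y | f y = f z']) z by rewrite UE.
Qed.

End Coordinates.

Section Cover.
Context {R : realType}.
Implicit Types (U : set 'rV[R]_2) (p : 'rV[R]_(2 + 2)).

Lemma open_cover U : open U -> open (cover U).
Proof.
by move=> oU; apply: open_comp => // p _; exact: continuous_lsubmx.
Qed.

Lemma lsubmx_delta_l (i : 'I_2) :
  lsubmx ('e_(lshift 2 i) : 'rV[R]_(2 + 2)) = 'e_i.
Proof. by apply/rowP => j; rewrite !mxE !eqxx (inj_eq (@lshift_inj _ _)). Qed.

Lemma lsubmx_delta_r (i : 'I_2) :
  lsubmx ('e_(rshift 2 i) : 'rV[R]_(2 + 2)) = 0.
Proof. by apply/rowP => j; rewrite !mxE !eqxx eq_lrshift. Qed.

Lemma partial_lift_l (f : 'rV[R]_2 -> R) (i : 'I_2) p :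
  partial (lshift 2 i) (f \o lsubmx) p = partial i f (lsubmx p).
Proof.
by apply: eq_along_derive => h; rewrite /= linearD linearZ /= lsubmx_delta_l.
Qed.

Lemma partial_lift_r (f : 'rV[R]_2 -> R) (i : 'I_2) p :
  partial (rshift 2 i) (f \o lsubmx) p = 0.
Proof.
rewrite -[RHS](derive_cst (f (lsubmx p)) p ('e_(rshift 2 i))).
apply: eq_along_derive => h.
by rewrite /= linearD linearZ /= lsubmx_delta_r scaler0 add0r.
Qed.

Lemma smooth_on_lift U (f : 'rV[R]_2 -> R) : open U -> smooth_on U f ->
  smooth_on (cover U) (f \o lsubmx).
Proof.
move=> oU sf; apply: (@smooth_on_coind _ _ _
  (fun F => exists2 f, smooth_on U f & F = f \o lsubmx)); last by exists f.
- exact: open_cover.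
- move=> _ [{sf}f sf ->]; split=> [p Up|i].
    apply: differentiable_comp; first exact: differentiable_lsubmx.
    exact: (smooth_on_differentiable sf Up).
  case: (split_ordP i) => j ->.
    exists (partial j f \o lsubmx); last by move=> p _; exact: partial_lift_l.
    by exists (partial j f) => //; exact: smooth_on_partial.
  exists (cst 0 \o lsubmx); last by move=> p _; exact: partial_lift_r.
  by exists (cst 0) => //; exact: smooth_on_cst.
Qed.

(** Restricting to this section turns an invariant function on the covering into
    a function on the base. *)
Definition zero_section (z : 'rV[R]_2) : 'rV[R]_(2 + 2) := row_mx z 0.

Lemma zero_sectionK z : lsubmx (zero_section z) = z.
Proof. exact: row_mxKl. Qed.

Lemma partial_zero_section (f : 'rV[R]_(2 + 2) -> R) (i : 'I_2) z :
  partial i (f \o zero_section) z = partial (lshift 2 i) f (zero_section z).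
Proof.
apply: eq_along_derive => h; congr f; apply/rowP => j.
rewrite [RHS]mxE /zero_section; case: (split_ordP j) => k ->.
  by rewrite !row_mxEl !mxE !eqxx (inj_eq (@lshift_inj _ _)).
by rewrite !row_mxEr !mxE eqxx eq_rlshift /= mulr0 add0r.
Qed.

Lemma differentiable_zero_section z : differentiable zero_section z.
Proof.
have sl : linear zero_section.
  by move=> a u v; rewrite /zero_section scale_row_mx add_row_mx scaler0 addr0.
pose L := GRing.isLinear.Build _ _ _ _ zero_section sl.
pose s : {linear 'rV[R]_2 -> 'rV[R]_(2 + 2)} := HB.pack zero_section L.
rewrite (_ : zero_section = s) //; apply: linear_differentiable.
move=> u A /nbhs_ballP[e /= e0 eA].
apply/nbhs_ballP; exists e => //= v [_ uv]; apply: eA; split => // i j.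
rewrite /= /zero_section; case: (split_ordP j) => k ->.
  by rewrite !row_mxEl; exact: uv.
by rewrite !row_mxEr; exact: ballxx.
Qed.

Lemma smooth_on_zero_section U (f : 'rV[R]_(2 + 2) -> R) :
  open U -> smooth_on (cover U) f -> smooth_on U (f \o zero_section).
Proof.
move=> oU sf; apply: (@smooth_on_coind _ _ _
  (fun F => exists2 f, smooth_on (cover U) f & F = f \o zero_section));
  [exact: oU| |by exists f].
move=> _ [{sf}f sf ->]; split=> [z Uz|i].
  apply: differentiable_comp; first exact: differentiable_zero_section.
  by apply: (smooth_on_differentiable sf); rewrite /cover /= zero_sectionK.
exists (partial (lshift 2 i) f \o zero_section).
  by exists (partial (lshift 2 i) f) => //; exact: smooth_on_partial.
by move=> z _; exact: partial_zero_section.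
Qed.

End Cover.

(** * Averages along a direction *)

Section UnitMean.
Context {R : realType}.
Implicit Types (phi psi : R -> R).

Definition unit_mean phi : R := \int[(@lebesgue_measure R)]_(t in `[0, 1]) phi t.

Lemma unit_mean_integrable phi : continuous phi ->
  (@lebesgue_measure R).-integrable (`[0, 1]%classic : set R) (EFin \o phi).
Proof.
move=> cphi; apply: continuous_compact_integrable; first exact: segment_compact.
exact: continuous_subspaceT.
Qed.

Lemma unit_meanD phi psi : continuous phi -> continuous psi ->
  unit_mean (fun t => phi t + psi t) = unit_mean phi + unit_mean psi.
Proof. by move=> cf cg; apply: RintegralD => //; exact: unit_mean_integrable. Qed.

Lemma unit_meanZ (c : R) phi : continuous phi ->
  unit_mean (fun t => c * phi t) = c * unit_mean phi.
Proof. by move=> cf; apply: RintegralZl => //; exact: unit_mean_integrable. Qed.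

Lemma unit_mean_cst (c : R) : unit_mean (fun=> c) = c.
Proof.
by rewrite /unit_mean Rintegral_cst//= lebesgue_measure_itv/= lte01 oppr0 adde0 mulr1.
Qed.

Lemma continuous_sum n (F : 'I_n -> R -> R) : (forall i, continuous (F i)) ->
  continuous (fun t => \sum_i F i t).
Proof.
by move=> cF; apply: continuous_big => [|i _]; [exact: add_continuous|exact: cF].
Qed.

Lemma unit_mean_sum n (F : 'I_n -> R -> R) : (forall i, continuous (F i)) ->
  unit_mean (fun t => \sum_i F i t) = \sum_i unit_mean (F i).
Proof.
move=> cF.
suff : forall s : seq 'I_n, continuous (fun t => \sum_(i <- s) F i t) /\
    unit_mean (fun t => \sum_(i <- s) F i t) = \sum_(i <- s) unit_mean (F i).
  by move=> /(_ (index_enum _))[].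
elim=> [|i s [cs IH]].
  rewrite (_ : (fun t => _) = (fun=> 0)); last by apply/funext => t; rewrite big_nil.
  by rewrite big_nil unit_mean_cst; split=> // t; exact: cvg_cst.
rewrite (_ : (fun t => _) = (fun t => F i t + \sum_(i <- s) F i t)); last first.
  by apply/funext => t; rewrite big_cons.
by rewrite big_cons unit_meanD// IH; split=> // t; apply: cvgD; [exact: cF|exact: cs].
Qed.

Lemma unit_mean_norm_le phi (c : R) : continuous phi ->
  (forall t, 0 <= t <= 1 -> `|phi t| <= c) -> `|unit_mean phi| <= c.
Proof.
move=> cf fc; rewrite -[leRHS]unit_mean_cst.
have If := unit_mean_integrable cf.
apply: (le_trans (le_normr_Rintegral _ If)) => //.
apply: le_Rintegral => //.
- exact: integrable_norm If.
- by apply: unit_mean_integrable; exact: cst_continuous.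
Qed.

Lemma unit_mean_derive phi (Phi : R -> R) : continuous phi ->
  (forall t : R, is_derive t 1 Phi (phi t)) -> unit_mean phi = Phi 1 - Phi 0.
Proof.
move=> cphi dPhi.
have cPhi t : {for t, continuous Phi}.
  by apply/differentiable_continuous/derivable1_diffP; have [] := dPhi t.
rewrite /unit_mean /Rintegral (@continuous_FTC2 _ phi Phi) ?ltr01//.
- exact: continuous_subspaceT.
- split=> [t _||].
  + by have [] := dPhi t.
  + by apply: cvg_at_right_filter; exact: cPhi.
  + by apply: cvg_at_left_filter; exact: cPhi.
- by move=> t _; rewrite derive1E; have [_] := dPhi t.
Qed.

End UnitMean.

Section Averaging.
Context {R : realType} {n : nat}.
Variables (v : 'rV[R]_n) (D : set 'rV[R]_n).
Hypothesis openD : open D.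
Hypothesis transD : forall p (t : R), D p -> D (t *: v + p).
Implicit Types (f g : 'rV[R]_n -> R) (p : 'rV[R]_n).

Definition average f p : R := unit_mean (fun t => f (t *: v + p)).

Lemma line_continuous p : continuous (fun t : R => t *: v + p).
Proof. by move=> t; apply: cvgD; [exact: scalel_continuous|exact: cvg_cst]. Qed.

Lemma smooth_line_continuous f p : smooth_on D f -> D p ->
  continuous (fun t : R => f (t *: v + p)).
Proof.
move=> sf Dp t; apply: (@continuous_comp _ _ _ (fun t : R => t *: v + p) f).
  exact: line_continuous.
by apply: (smooth_on_continuous sf); exact: transD.
Qed.

(** By strict differentiability and compactness of [0, 1], the error of the linear
    approximation of f at t *: v + p is at most e * |h| for small h, uniformly in
    t. This bound is then integrated in t. *)
Lemma average_increment f p (e : R) : smooth_on D f -> D p -> 0 < e ->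
  \forall h \near (0 : 'rV[R]_n), `|average f (h + p) - average f p
     - \sum_i h 0 i * average (partial i f) p| <= e * `|h|.
Proof.
move=> sf Dp e0.
have spf i : smooth_on D (partial i f) by exact: smooth_on_partial.
have unif : \forall h \near (0 : 'rV[R]_n), (`[0, 1]%classic : set R) `<=`
    (fun t => `|f (t *: v + (h + p)) - f (t *: v + p)
        - \sum_i h 0 i * partial i f (t *: v + p)| <= e * `|h|).
  have /compact_near_coveringP K := @segment_compact R 0 1.
  apply: (K _ (nbhs (0 : 'rV[R]_n)) (fun h t => `|f (t *: v + (h + p)) - f (t *: v + p)
        - \sum_i h 0 i * partial i f (t *: v + p)| <= e * `|h|)) => t _.
  have Dt : D (t *: v + p) by exact: transD.
  have := @strictly_differentiable _ _ f (t *: v + p)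
    (near_in_open openD (fun z => @smooth_on_differentiable _ _ D f z sf) Dt)
    (fun i => smooth_on_continuous (spf i) Dt) e e0.
  move=> [[/= A B] [At B0] AB].
  exists ((fun t => A (t *: v + p)), B); first by split=> //; exact: line_continuous.
  move=> [t' h] /= [At' Bh].
  by rewrite [t' *: v + (h + p)]addrCA; exact: (AB (t' *: v + p, h)).
have Dnear : \forall h \near (0 : 'rV[R]_n), D (h + p).
  rewrite (near_shift p) sub0r; near=> z => /=; rewrite subrK.
  by near: z; exact: open_nbhs_nbhs.
apply: filterS2 Dnear unif => h Dhp hle.
have cf q : D q -> continuous (fun t : R => f (t *: v + q)).
  exact: smooth_line_continuous.
have cp i : continuous (fun t : R => h 0 i * partial i f (t *: v + p)).
  by move=> t; apply: cvgM; [exact: cvg_cst|exact: smooth_line_continuous].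
have -> : average f (h + p) - average f p - \sum_i h 0 i * average (partial i f) p =
    unit_mean (fun t => f (t *: v + (h + p)) +
      (-1 * f (t *: v + p) + -1 * \sum_i h 0 i * partial i f (t *: v + p))).
  have cS : continuous (fun t : R => \sum_i h 0 i * partial i f (t *: v + p)).
    exact: continuous_sum cp.
  rewrite unit_meanD; [|exact: cf|].
    rewrite unit_meanD; [|move=> t; apply: cvgM; [exact: cvg_cst|exact: cf]|
      move=> t; apply: cvgM; [exact: cvg_cst|exact: cS]].
    rewrite unit_meanZ; last exact: cf.
    rewrite unit_meanZ; last exact: cS.
    rewrite unit_mean_sum//.
    under [in RHS]eq_bigr => i _.
      rewrite unit_meanZ; last exact: smooth_line_continuous.
      over.
    by rewrite /average; ring.
  by move=> t; apply: cvgD; apply: cvgM; [exact: cvg_cst|exact: cf|exact: cvg_cst|exact: cS].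
apply: unit_mean_norm_le.
  move=> t; apply: cvgD; first exact: cf.
  apply: cvgD; apply: cvgM; [exact: cvg_cst|exact: cf|exact: cvg_cst|].
  exact: continuous_sum cp t.
move=> t t01; have := hle t; rewrite /= in_itv/= => /(_ t01).
by move=> le_t; rewrite !mulN1r [X in `|X|]addrA.
Unshelve. all: by end_near. Qed.

(** What is left after removing the linear part with coefficients
    average (partial i f) p has small increments. *)
Lemma average_differentiable f p : smooth_on D f -> D p ->
  differentiable (average f) p /\
  forall i, partial i (average f) p = average (partial i f) p.
Proof.
move=> sf Dp.
pose c i := average (partial i f) p.
pose L : 'rV[R]_n -> R := \sum_i (c i *: (fun z : 'rV[R]_n => z 0 i)).
have LE z : L z = \sum_i c i * z 0 i by rewrite /L fct_sumE.
have dL z : differentiable L z.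
  apply: differentiable_sum => i; apply: differentiableZ.
  exact: differentiable_coord.
have pL i : partial i L p = c i.
  rewrite /partial derive_partial// (bigD1 i)//= big1 ?addr0 => [|j ji].
    rewrite mxE !eqxx mul1r.
    have -> : partial i L p = \sum_j c j * partial i (fun z => z 0 j) p.
      rewrite /partial derive_sum => [|j].
        apply: eq_bigr => j _; rewrite deriveZ//.
        exact/diff_derivable/differentiable_coord.
      by apply/derivableZ/diff_derivable/differentiable_coord.
    rewrite (bigD1 i)//= big1 ?addr0 => [|j ji].
      by rewrite (@partial_coord _ _ id) derive1_id mulr1.
    by rewrite (@partial_other_coord _ _ id) ?mulr0// eq_sym.
  by rewrite mxE eqxx (negbTE ji) mul0r.
pose g := average f - L.
have [dg g0] : differentiable g p /\ forall w, 'D_w g p = 0.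
  apply: small_increment_differentiable => e e0.
  apply: filterS (average_increment sf Dp e0) => h.
  rewrite /g !fctE !LE; congr (`|_| <= _).
  under [in RHS]eq_bigr do rewrite mxE mulrDr.
  rewrite big_split /=; under eq_bigr do rewrite mulrC.
  by rewrite /c; ring.
have E : average f = g + L by rewrite /g subrK.
split=> [|i]; first by rewrite E; exact: differentiableD.
by rewrite E partialD// pL -[partial i g p]/('D_('e_i) g p) g0 add0r.
Qed.

Lemma smooth_on_average f : smooth_on D f -> smooth_on D (average f).
Proof.
move=> sf; apply: (@smooth_on_coind _ _ _
  (fun F => exists2 f, smooth_on D f & F = average f)); [exact: openD| |by exists f].
move=> _ [{sf}f sf ->]; split=> [p Dp|i]; first by have [] := average_differentiable sf Dp.
exists (average (partial i f)); first by exists (partial i f) => //; exact: smooth_on_partial.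
by move=> p Dp; have [] := average_differentiable sf Dp.
Qed.

(** The derivative along v is the integral over [0, 1] of the derivative of
    t |-> f (t *: v + p), that is, the increment of f over one period. *)
Lemma derive_average_periodic f p : smooth_on D f -> D p ->
  (forall q, D q -> f (v + q) = f q) -> 'D_v (average f) p = 0.
Proof.
move=> sf Dp vper.
have [dav pav] := average_differentiable sf Dp.
have spf i : smooth_on D (partial i f) by exact: smooth_on_partial.
have -> : 'D_v (average f) p =
    \sum_i unit_mean (fun t => v 0 i * partial i f (t *: v + p)).
  rewrite derive_partial//; apply: eq_bigr => i _.
  by rewrite pav unit_meanZ//; exact: smooth_line_continuous.
rewrite -unit_mean_sum; last first.
  by move=> i t; apply: cvgM; [exact: cvg_cst|exact: smooth_line_continuous].
have cS : continuous (fun t : R => \sum_i v 0 i * partial i f (t *: v + p)).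
  apply: continuous_sum => i t.
  by apply: cvgM; [exact: cvg_cst|exact: smooth_line_continuous].
have dS (t : R) : is_derive t 1 (fun t : R => f (t *: v + p))
    (\sum_i v 0 i * partial i f (t *: v + p)).
  have dft : differentiable f (t *: v + p).
    by apply: (smooth_on_differentiable sf); exact: transD.
  by rewrite -derive_partial//; apply: is_derive_along; exact: diff_derivable.
by have -> := unit_mean_derive cS dS; rewrite scale1r scale0r add0r vper// subrr.
Qed.

End Averaging.

(** * Curvature of the torus metric *)

Section HasPartial.
Context {R : realType} {n : nat}.
Implicit Types (f g : 'rV[R]_n -> R) (z : 'rV[R]_n) (i : 'I_n).

(** As a relation, a derivative can be computed by following the syntax of the
    function, the value being filled in on the way. *)
Definition has_partial i f z (d : R) := derivable f z 'e_i /\ partial i f z = d.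

Lemma has_partialP i f z : differentiable f z -> has_partial i f z (partial i f z).
Proof. by move=> df; split=> //; exact: diff_derivable. Qed.

Lemma has_partial_cst i (c : R) z : has_partial i (fun=> c) z 0.
Proof. by split; [exact: derivable_cst|exact: derive_cst]. Qed.

Lemma has_partialD i f g z a b : has_partial i f z a -> has_partial i g z b ->
  has_partial i (fun z => f z + g z) z (a + b).
Proof. by move=> [df <-] [dg <-]; split; [exact: (derivableD df dg)|exact: (deriveD df dg)]. Qed.

Lemma has_partialN i f z a : has_partial i f z a ->
  has_partial i (fun z => - f z) z (- a).
Proof. by move=> [df <-]; split; [exact: (derivableN df)|exact: (deriveN df)]. Qed.

Lemma has_partialM i f g z a b : has_partial i f z a -> has_partial i g z b ->
  has_partial i (fun z => f z * g z) z (f z * b + g z * a).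
Proof. by move=> [df <-] [dg <-]; split; [exact: (derivableM df dg)|exact: (deriveM df dg)]. Qed.

Lemma has_partialX2 i f z a : has_partial i f z a ->
  has_partial i (fun z => f z ^+ 2) z (2 * f z * a).
Proof.
move=> hf; rewrite (_ : (fun z => _) = (fun z => f z * f z)); last first.
  by apply/funext => y; rewrite expr2.
by rewrite -mulrA mulr_natl mulr2n; exact: has_partialM.
Qed.

Lemma has_partialV i f z a : f z != 0 -> has_partial i f z a ->
  has_partial i (fun z => (f z)^-1) z (- a / f z ^+ 2).
Proof.
move=> fz [df <-]; split; first exact: (derivableV fz df).
by rewrite /partial (deriveV fz df) mulNr mulrC -mulNr.
Qed.

Lemma partial_eq i f z d d' : has_partial i f z d -> d = d' -> partial i f z = d'.
Proof. by move=> [_ <-]. Qed.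

End HasPartial.

Section FourIndices.

Definition i_x : 'I_(2 + 2) := @Ordinal 4 0 isT.
Definition i_y : 'I_(2 + 2) := @Ordinal 4 1 isT.
Definition i_s : 'I_(2 + 2) := @Ordinal 4 2 isT.
Definition i_t : 'I_(2 + 2) := @Ordinal 4 3 isT.

Lemma ind4 (P : 'I_(2 + 2) -> Prop) : P i_x -> P i_y -> P i_s -> P i_t -> forall i, P i.
Proof.
move=> Px Py Ps Pt [[|[|[|[|i]]]] h] //.
- by rewrite (_ : Ordinal h = i_x)//; exact: val_inj.
- by rewrite (_ : Ordinal h = i_y)//; exact: val_inj.
- by rewrite (_ : Ordinal h = i_s)//; exact: val_inj.
- by rewrite (_ : Ordinal h = i_t)//; exact: val_inj.
Qed.

Lemma sum4 (R : nmodType) (F : 'I_(2 + 2) -> R) :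
  \sum_i F i = F i_x + F i_y + F i_s + F i_t.
Proof.
rewrite !big_ord_recl big_ord0 addr0 !addrA.
by congr (_ + _ + _ + _); congr F; exact: val_inj.
Qed.

End FourIndices.

Section BasePartial.
Context {R : realType}.

(** The derivatives in the four directions of the covering, for functions of the
    base point only. *)
Definition base_partial (i : 'I_(2 + 2)) (f : 'rV[R]_2 -> R) : 'rV[R]_2 -> R :=
  match nat_of_ord i with 0 => partial 0 f | 1 => partial 1 f | _ => fun=> 0 end.

Lemma partial_lift i (f : 'rV[R]_2 -> R) p :
  partial i (f \o lsubmx) p = base_partial i f (lsubmx p).
Proof.
elim/ind4: i.
- by rewrite (_ : i_x = lshift 2 0) ?partial_lift_l//; exact: val_inj.
- by rewrite (_ : i_y = lshift 2 1) ?partial_lift_l//; exact: val_inj.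
- by rewrite (_ : i_s = rshift 2 0) ?partial_lift_r//; exact: val_inj.
- by rewrite (_ : i_t = rshift 2 1) ?partial_lift_r//; exact: val_inj.
Qed.

End BasePartial.

(** The profiles A, B, the conformal factor q and their derivatives, as opaque
    functions whose derivatives are again components of the record. This is what
    makes curvature a computation with rational functions of independent
    variables. The component [jr] is the square root of A B, and [jqxy] is
    both mixed derivatives of q. The parameter k stands for cos theta. *)
Record torus_jet {R : realType} (U : set 'rV[R]_2) (k : R) := TorusJet {
  jA : 'rV[R]_2 -> R; jdA : 'rV[R]_2 -> R; jddA : 'rV[R]_2 -> R;
  jB : 'rV[R]_2 -> R; jdB : 'rV[R]_2 -> R; jddB : 'rV[R]_2 -> R;
  jr : 'rV[R]_2 -> R;
  jq : 'rV[R]_2 -> R; jqx : 'rV[R]_2 -> R; jqy : 'rV[R]_2 -> R;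
  jqxx : 'rV[R]_2 -> R; jqxy : 'rV[R]_2 -> R; jqyy : 'rV[R]_2 -> R;
  jA_neq0 : forall z, U z -> jA z != 0;
  jr_neq0 : forall z, U z -> jr z != 0;
  jq_neq0 : forall z, U z -> jq z != 0;
  jr2 : forall z, U z -> jr z ^+ 2 = jA z * jB z;
  jA_x : forall z, U z -> has_partial 0 jA z (jdA z);
  jA_y : forall z, U z -> has_partial 1 jA z 0;
  jdA_x : forall z, U z -> has_partial 0 jdA z (jddA z);
  jdA_y : forall z, U z -> has_partial 1 jdA z 0;
  jB_x : forall z, U z -> has_partial 0 jB z 0;
  jB_y : forall z, U z -> has_partial 1 jB z (jdB z);
  jdB_x : forall z, U z -> has_partial 0 jdB z 0;
  jdB_y : forall z, U z -> has_partial 1 jdB z (jddB z);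
  jr_x : forall z, U z -> has_partial 0 jr z (jr z * jdA z / (2 * jA z));
  jr_y : forall z, U z -> has_partial 1 jr z (jr z * jdB z / (2 * jB z));
  jq_x : forall z, U z -> has_partial 0 jq z (jqx z);
  jq_y : forall z, U z -> has_partial 1 jq z (jqy z);
  jqx_x : forall z, U z -> has_partial 0 jqx z (jqxx z);
  jqx_y : forall z, U z -> has_partial 1 jqx z (jqxy z);
  jqy_x : forall z, U z -> has_partial 0 jqy z (jqxy z);
  jqy_y : forall z, U z -> has_partial 1 jqy z (jqyy z) }.

Lemma soliton_entries (R : comNzRingType) m (M N P : 'M[R]_m) (c l : R) :
  M + c *: N = l *: P <-> forall i j, M i j + c * N i j = l * P i j.
Proof.
split=> [/matrixP E i j|E]; first by have := E i j; rewrite !mxE.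
by apply/matrixP => i j; rewrite !mxE.
Qed.

Section TorusGeometry.
Context {R : realType} (U : set 'rV[R]_2) (k : R) (J : torus_jet U k).
Hypothesis openU : open U.
Hypothesis k1 : 1 - k ^+ 2 != 0.
Notation A := (jA J).
Notation dA := (jdA J).
Notation ddA := (jddA J).
Notation B := (jB J).
Notation dB := (jdB J).
Notation ddB := (jddB J).
Notation r := (jr J).
Notation q := (jq J).
Notation qx := (jqx J).
Notation qy := (jqy J).
Notation qxx := (jqxx J).
Notation qxy := (jqxy J).
Notation qyy := (jqyy J).

Lemma jB_eq z : U z -> B z = r z ^+ 2 / A z.
Proof. by move=> Uz; rewrite jr2// mulrC mulKf// jA_neq0. Qed.

Lemma jB_neq0 z : U z -> B z != 0.
Proof.
by move=> Uz; rewrite jB_eq// mulf_neq0 ?expf_neq0 ?invr_eq0 ?jA_neq0 ?jr_neq0.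
Qed.

(** Missing rows and entries count as zero. *)
Definition tab (m : seq (seq R)) (i j : 'I_(2 + 2)) : R := nth 0 (nth [::] m i) j.

Definition metric z : 'M[R]_(2 + 2) :=
  let a := A z in let b := B z in let c := r z * k in
  (q z ^+ 2)^-1 *: \matrix_(i, j) tab
    [:: [:: a^-1; 0;    0; 0];
        [:: 0;    b^-1; 0; 0];
        [:: 0;    0;    a; c];
        [:: 0;    0;    c; b]] i j.

Definition inverse_metric z : 'M[R]_(2 + 2) :=
  let s := 1 - k ^+ 2 in
  q z ^+ 2 *: \matrix_(i, j) tab
    [:: [:: A z; 0; 0; 0];
        [:: 0; B z; 0; 0];
        [:: 0; 0; (A z * s)^-1; - k / (r z * s)];
        [:: 0; 0; - k / (r z * s); (B z * s)^-1]] i j.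

(** The derivative of the (i, j) entry of the metric in the direction l. There are
    no tables for the fibre directions, so these derivatives are zero. *)
Definition dmetric (l : 'I_(2 + 2)) z (i j : 'I_(2 + 2)) : R :=
  let a := A z in let b := B z in
  let da := dA z in let db := dB z in
  let X := qx z / q z in let Y := qy z / q z in
  (q z ^+ 2)^-1 * tab (nth [::] [::
    [:: [:: - (da / a + 2 * X) / a; 0; 0; 0];
        [:: 0; - (2 * X) / b; 0; 0];
        [:: 0; 0; da - 2 * X * a; (da / (2 * a) - 2 * X) * r z * k];
        [:: 0; 0; (da / (2 * a) - 2 * X) * r z * k; - (2 * X) * b]];
    [:: [:: - (2 * Y) / a; 0; 0; 0];
        [:: 0; - (db / b + 2 * Y) / b; 0; 0];
        [:: 0; 0; - (2 * Y) * a; (db / (2 * b) - 2 * Y) * r z * k];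
        [:: 0; 0; (db / (2 * b) - 2 * Y) * r z * k; db - 2 * Y * b]]] l) i j.

(** The Christoffel symbol with upper index l and lower indices i, j, for
    a = A' / (2 A), b = B' / (2 B), X = q_x / q, Y = q_y / q. Taking numbers
    instead of a point as arguments allows them to be replaced by variables before
    the table is unfolded. *)
Definition connection (A' B' a b r' X Y : R) (l i j : 'I_(2 + 2)) : R :=
  let s := 1 - k ^+ 2 in
  tab (nth [::] [::
    [:: [:: - a - X; - Y; 0; 0];
        [:: - Y; X * A' / B'; 0; 0];
        [:: 0; 0; A' ^+ 2 * (X - a); A' * r' * k * (X - a / 2)];
        [:: 0; 0; A' * r' * k * (X - a / 2); A' * B' * X]];
    [:: [:: Y * B' / A'; - X; 0; 0];
        [:: - X; - b - Y; 0; 0];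
        [:: 0; 0; A' * B' * Y; B' * r' * k * (Y - b / 2)];
        [:: 0; 0; B' * r' * k * (Y - b / 2); B' ^+ 2 * (Y - b)]];
    [:: [:: 0; 0; a / 2 * (1 + s^-1) - X; a / 2 * k * r' / (A' * s)];
        [:: 0; 0; - b / 2 * k ^+ 2 / s - Y; - b / 2 * k * r' / (A' * s)];
        [:: a / 2 * (1 + s^-1) - X; - b / 2 * k ^+ 2 / s - Y; 0; 0];
        [:: a / 2 * k * r' / (A' * s); - b / 2 * k * r' / (A' * s); 0; 0]];
    [:: [:: 0; 0; - a / 2 * k * r' / (B' * s); - a / 2 * k ^+ 2 / s - X];
        [:: 0; 0; b / 2 * k * r' / (B' * s); b / 2 * (1 + s^-1) - Y];
        [:: - a / 2 * k * r' / (B' * s); b / 2 * k * r' / (B' * s); 0; 0];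
        [:: - a / 2 * k ^+ 2 / s - X; b / 2 * (1 + s^-1) - Y; 0; 0]]] l) i j.

Definition gamma (l i j : 'I_(2 + 2)) z : R :=
  connection (A z) (B z) (dA z / (2 * A z)) (dB z / (2 * B z)) (r z)
    (qx z / q z) (qy z / q z) l i j.

Lemma metricK z : U z -> invmx (metric z) = inverse_metric z.
Proof.
move=> Uz; suff E : metric z *m inverse_metric z = 1%:M.
  by have [u _] := mulmx1_unit E; rewrite -[RHS](mulKmx u) E mulmx1.
have [rz Az qz] := And3 (jr_neq0 J Uz) (jA_neq0 J Uz) (jq_neq0 J Uz).
apply/matrixP => i j; rewrite !mxE sum4 !mxE /tab jB_eq//.
by elim/ind4: i; elim/ind4: j => /=; field; rewrite ?k1 ?rz ?Az ?qz.
Qed.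

(** Derivatives of rational expressions in the components of J. What remains is
    that denominators do not vanish. *)
Ltac partials :=
  lazymatch goal with
  | |- has_partial _ (fun _ => ?c) _ _ => exact (has_partial_cst _ c _)
  | |- has_partial _ (fun z => @?f z + @?g z) _ _ =>
      eapply (@has_partialD _ _ _ f g); partials
  | |- has_partial _ (fun z => @?f z * @?g z) _ _ =>
      eapply (@has_partialM _ _ _ f g); partials
  | |- has_partial _ (fun z => - @?f z) _ _ =>
      eapply (@has_partialN _ _ _ f); partials
  | |- has_partial _ (fun z => @?f z ^+ 2) _ _ =>
      eapply (@has_partialX2 _ _ _ f); partials
  | |- has_partial _ (fun z => (@?f z)^-1) _ _ =>
      eapply (@has_partialV _ _ _ f); [idtac | partials]
  | |- has_partial _ (fun z => ?f z) _ _ => change (fun z => f z) with f; partials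
  | |- has_partial 0 A _ _ => apply jA_x; assumption
  | |- has_partial 1 A _ _ => apply jA_y; assumption
  | |- has_partial 0 dA _ _ => apply jdA_x; assumption
  | |- has_partial 1 dA _ _ => apply jdA_y; assumption
  | |- has_partial 0 B _ _ => apply jB_x; assumption
  | |- has_partial 1 B _ _ => apply jB_y; assumption
  | |- has_partial 0 dB _ _ => apply jdB_x; assumption
  | |- has_partial 1 dB _ _ => apply jdB_y; assumption
  | |- has_partial 0 r _ _ => apply jr_x; assumption
  | |- has_partial 1 r _ _ => apply jr_y; assumption
  | |- has_partial 0 q _ _ => apply jq_x; assumption
  | |- has_partial 1 q _ _ => apply jq_y; assumption
  | |- has_partial 0 qx _ _ => apply jqx_x; assumption
  | |- has_partial 1 qx _ _ => apply jqx_y; assumption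
  | |- has_partial 0 qy _ _ => apply jqy_x; assumption
  | |- has_partial 1 qy _ _ => apply jqy_y; assumption
  end.

Lemma partial_metric l i j z : U z ->
  base_partial l (fun z => metric z i j) z = dmetric l z i j.
Proof.
move=> Uz.
have E : (fun z => metric z i j) = (fun z => (q z ^+ 2)^-1 * tab
    [:: [:: (A z)^-1; 0;    0; 0];
        [:: 0;    (B z)^-1; 0; 0];
        [:: 0;    0;    A z; r z * k];
        [:: 0;    0;    r z * k; B z]] i j).
  by apply/funext => x; rewrite !mxE.
have [rz Az qz] := And3 (jr_neq0 J Uz) (jA_neq0 J Uz) (jq_neq0 J Uz); have Bz := jB_neq0 Uz.
rewrite E {E}; move: l i j; elim/ind4; rewrite /base_partial /dmetric /=.
1,2: by elim/ind4; elim/ind4; rewrite /tab /=;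
  (eapply partial_eq; [partials; rewrite ?expf_neq0 ?qz ?Az ?Bz // |]);
  rewrite ?(jB_eq Uz); field; rewrite ?rz ?Az ?qz.
1,2: by elim/ind4; elim/ind4; rewrite /tab /= mulr0.
Qed.

Lemma christoffel_metric l i j p : cover U p ->
  christoffel (metric \o lsubmx) l i j p = gamma l i j (lsubmx p).
Proof.
move=> Up; set z := lsubmx p; have Uz : U z by [].
have [rz Az qz] := And3 (jr_neq0 J Uz) (jA_neq0 J Uz) (jq_neq0 J Uz).
have dE m a b : partial m (fun x => (metric \o lsubmx) x a b) p = dmetric m z a b.
  by rewrite (@partial_lift _ m (fun z => metric z a b)) partial_metric.
rewrite /christoffel; under eq_bigr do rewrite !dE /=.
rewrite metricK// -/z sum4 /dmetric /gamma !mxE !(jB_eq Uz).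
move: (r z) (A z) (q z) (qx z) (qy z) (dA z) (dB z) rz Az qz.
move=> r' A' q' qx' qy' dA' dB' r'0 A'0 q'0.
elim/ind4: l; elim/ind4: i; elim/ind4: j; rewrite /connection /tab /=.
all: by field; rewrite ?k1 ?r'0 ?A'0 ?q'0.
Qed.

Lemma ricci_metric p i j : cover U p -> let z := lsubmx p in
  ricci (metric \o lsubmx) p i j =
    \sum_l base_partial l (gamma l i j) z
    - \sum_l base_partial j (gamma l i l) z
    + \sum_l \sum_m gamma l l m z * gamma m i j z
    - \sum_l \sum_m gamma l j m z * gamma m i l z.
Proof.
move=> Up z; rewrite !mxE.
have dE l m a b : partial l (christoffel (metric \o lsubmx) m a b) p =
    base_partial l (gamma m a b) z.
  rewrite -partial_lift; apply: (eq_on_derive _ (open_cover openU) _ Up) => x Ux.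
  by rewrite christoffel_metric.
congr (_ - _ + _ - _); apply: eq_bigr => l _; try exact: dE;
  by apply: eq_bigr => m _; rewrite (christoffel_metric _ _ _ Up)
    (christoffel_metric _ _ _ Up).
Qed.

Ltac eval_partials z rz Az Bz qz :=
  repeat match goal with |- context [partial ?i (gamma ?l ?a ?b) z] =>
    let H := fresh "H" in
    eassert (H : partial i (gamma l a b) z = _);
    [rewrite /gamma /connection /tab /=; eapply partial_eq;
      [partials; rewrite ?expf_neq0 ?mulf_neq0 ?pnatr_eq0 ?qz ?Az ?Bz ?rz //
      | reflexivity]
    | rewrite H; clear H]
  end.

(** The right-hand side contains only first derivatives of A and B: second
    derivatives, and everything that involves q, cancel. The combination on the left
    is the one that vanishes on the metric, because its (s, t) entry is k times the
    geometric mean of the (s, s) and (t, t) entries. *)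
Lemma ricci_fibre_relation p : cover U p -> let z := lsubmx p in
  let Ric i j := ricci (metric \o lsubmx) p i j in
  2 * Ric i_s i_t / r z - k * (Ric i_s i_s / A z + Ric i_t i_t / B z) =
  k * (dA z ^+ 2 / (4 * A z) + dB z ^+ 2 / (4 * B z)).
Proof.
move=> Up z Ric; have Uz : U z by [].
have [rz Az qz] := And3 (jr_neq0 J Uz) (jA_neq0 J Uz) (jq_neq0 J Uz); have Bz := jB_neq0 Uz.
rewrite /Ric !ricci_metric// -/z !sum4 /base_partial /=.
eval_partials z rz Az Bz qz.
rewrite /gamma (jB_eq Uz).
move: (qxx z) (qyy z) (qxy z) (qx z) (qy z) (q z) (r z) (A z)
  (dA z) (dB z) (ddA z) (ddB z) rz Az qz.
move=> qxx' qyy' qxy' qx' qy' q' r' A' dA' dB' ddA' ddB' r'0 A'0 q'0.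
rewrite /connection /tab /=.
by field; rewrite ?k1 ?r'0 ?A'0 ?q'0.
Qed.

Lemma metricE z i j : metric z i j = (q z ^+ 2)^-1 * tab
    [:: [:: (A z)^-1; 0;    0; 0];
        [:: 0;    (B z)^-1; 0; 0];
        [:: 0;    0;    A z; r z * k];
        [:: 0;    0;    r z * k; B z]] i j.
Proof. by rewrite !mxE. Qed.

(** For constant A and B the metric is q^-2 times a flat one, and this is the
    formula for a conformal change of a flat metric in dimension 4, with the Hessian
    of q and, in front of the metric, q Lap q - 3 |dq|^2. *)
Lemma ricci_flat_conformal p i j : cover U p -> let z := lsubmx p in
  dA z = 0 -> dB z = 0 -> ddA z = 0 -> ddB z = 0 ->
  ricci (metric \o lsubmx) p i j =
    2 / q z * tab [:: [:: qxx z; qxy z];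
                      [:: qxy z; qyy z]] i j
    + (q z * (A z * qxx z + B z * qyy z)
       - 3 * (A z * qx z ^+ 2 + B z * qy z ^+ 2)) * metric z i j.
Proof.
move=> Up z dA0 dB0 ddA0 ddB0; have Uz : U z by [].
have [rz Az qz] := And3 (jr_neq0 J Uz) (jA_neq0 J Uz) (jq_neq0 J Uz); have Bz := jB_neq0 Uz.
rewrite (ricci_metric _ _ Up).
rewrite metricE.
rewrite -/z.
move: i j; elim/ind4; elim/ind4.
all: rewrite !sum4 /base_partial /=.
all: eval_partials z rz Az Bz qz.
all: rewrite /gamma (jB_eq Uz) ?dA0 ?dB0 ?ddA0 ?ddB0.
all: move: (qxx z) (qyy z) (qxy z) => qxx' qyy' qxy'.
all: move: (qx z) (qy z) (q z) (r z) (A z) rz Az qz => qx' qy' q' r' A' r'0 A'0 q'0.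
all: rewrite /connection /tab /=.
all: by field; rewrite ?k1 ?r'0 ?A'0 ?q'0.
Qed.

Lemma lie_metric_entry (V : 'rV[R]_(2 + 2) -> 'rV[R]_(2 + 2)) p i j :
  cover U p -> let z := lsubmx p in
  lie_metric V (metric \o lsubmx) p i j =
    \sum_l (V p 0 l * dmetric l z i j
      + metric z l j * partial i (fun x => V x 0 l) p
      + metric z i l * partial j (fun x => V x 0 l) p).
Proof.
move=> Up z; rewrite mxE; apply: eq_bigr => l _; congr (_ * _ + _ + _).
by rewrite -partial_metric// -partial_lift.
Qed.

(** * The soliton equation for invariant fields *)

Definition soliton_eq (V : 'rV[R]_(2 + 2) -> 'rV[R]_(2 + 2)) lambda p :=
  ricci (metric \o lsubmx) p + 2^-1 *: lie_metric V (metric \o lsubmx) p =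
  lambda *: (metric \o lsubmx) p.

(** The Lie derivative of the fibre block is the derivative of its entries along
    the field, and it is killed by the combination of [ricci_fibre_relation] because
    r is the geometric mean of A and B. Only the sum of squares on the right of that
    relation is left. *)
Lemma invariant_soliton_constant (V : 'rV[R]_(2 + 2) -> 'rV[R]_(2 + 2)) lambda p :
  cover U p -> let z := lsubmx p in
  k != 0 -> 0 < A z -> 0 < B z ->
  (forall l, partial i_s (fun x => V x 0 l) p = 0) ->
  (forall l, partial i_t (fun x => V x 0 l) p = 0) ->
  soliton_eq V lambda p ->
  dA z = 0 /\ dB z = 0.
Proof.
move=> Up z k0 Agt0 Bgt0 Vs Vt E; have Uz : U z by [].
have [rz Az qz] := And3 (jr_neq0 J Uz) (jA_neq0 J Uz) (jq_neq0 J Uz).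
have Ric i j : ricci (metric \o lsubmx) p i j = lambda * metric z i j -
    2^-1 * lie_metric V (metric \o lsubmx) p i j.
  by rewrite -(iffLR (soliton_entries _ _ _ _ _) E i j) addrK.
have := ricci_fibre_relation Up; rewrite /= -/z !Ric !lie_metric_entry// -/z.
rewrite !sum4 !Vs !Vt /dmetric !metricE /tab /= => fib.
have : k * (dA z ^+ 2 / (4 * A z) + dB z ^+ 2 / (4 * B z)) = 0.
  rewrite -fib (jB_eq Uz).
  move: (qx z) (qy z) (q z) (r z) (A z) (dA z) (dB z) rz Az qz.
  by move=> *; field; apply/and3P.
move/eqP; rewrite mulf_eq0 (negbTE k0) /= paddr_eq0; last 2 first.
- by rewrite divr_ge0 ?sqr_ge0// mulr_ge0 ?ltW.
- by rewrite divr_ge0 ?sqr_ge0// mulr_ge0 ?ltW.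
rewrite !mulf_eq0 !invr_eq0 !mulf_eq0 (negbTE Az) (negbTE (jB_neq0 Uz)) !pnatr_eq0 /= !orbF !orbb.
by move=> /andP[/eqP-> /eqP->].
Qed.

(** The soliton equation for constant A and B. The first three equations say that
    the symmetrised derivative of the field, with its index lowered by the flat
    metric dx^2 / A + dy^2 / B, is - 2 q times the Hessian of q. *)
Definition flat_soliton_system (V : 'rV[R]_(2 + 2) -> 'rV[R]_(2 + 2)) lambda p :=
  let z := lsubmx p in
  let d i l := partial i (fun x => V x 0 l) p in
  [/\ d i_x i_x = - (2 * q z * qxx z * A z), d i_y i_y = - (2 * q z * qyy z * B z),
      B z * d i_y i_x + A z * d i_x i_y = - (4 * q z * qxy z * A z * B z) &
      lambda = q z * (A z * qxx z + B z * qyy z)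
        - 3 * (A z * qx z ^+ 2 + B z * qy z ^+ 2)
        - (V p 0 i_x * qx z + V p 0 i_y * qy z) / q z].

(** With u = v an equation already known, the side condition is an identity that
    [field] or [ring] can check. *)
Lemma eq_of_proportional (x y u v c : R) : u = v -> x - y = c * (u - v) -> x = y.
Proof. by move=> -> /eqP; rewrite subrr mulr0 subr_eq0 => /eqP. Qed.

(** The (s, s) entry gives lambda. With this value the multiples of the metric drop
    out of the entries of the base block. *)
Lemma flat_soliton_necessary (V : 'rV[R]_(2 + 2) -> 'rV[R]_(2 + 2)) lambda p :
  cover U p -> let z := lsubmx p in
  dA z = 0 -> dB z = 0 -> ddA z = 0 -> ddB z = 0 ->
  (forall l, partial i_s (fun x => V x 0 l) p = 0) ->
  (forall l, partial i_t (fun x => V x 0 l) p = 0) ->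
  soliton_eq V lambda p -> flat_soliton_system V lambda p.
Proof.
move=> Up z dA0 dB0 ddA0 ddB0 Vs Vt /soliton_entries E; have Uz : U z by [].
have [rz Az qz] := And3 (jr_neq0 J Uz) (jA_neq0 J Uz) (jq_neq0 J Uz).
have := E i_s i_s; have := E i_x i_x; have := E i_y i_y; have := E i_x i_y.
rewrite /flat_soliton_system !ricci_flat_conformal// !lie_metric_entry// -/z.
rewrite !sum4 !Vs /dmetric /= !metricE -/z dA0 dB0 /tab /= (jB_eq Uz) {E Vs Vt}.
move: (partial i_x (fun x => V x 0 i_x) p) (partial i_y (fun x => V x 0 i_y) p)
  (partial i_y (fun x => V x 0 i_x) p) (partial i_x (fun x => V x 0 i_y) p)
  (partial i_y (fun x => V x 0 i_s) p) (partial i_x (fun x => V x 0 i_s) p)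
  (partial i_y (fun x => V x 0 i_t) p) (partial i_x (fun x => V x 0 i_t) p)
  => dxx dyy dyx dxy dys dxs dyt dxt.
move: (V p 0 i_x) (V p 0 i_y) (V p 0 i_s) (V p 0 i_t) => vx vy vs vt.
move: (qxx z) (qyy z) (qxy z) (qx z) (qy z) (q z) (r z) (A z) rz Az qz.
move=> qxx' qyy' qxy' qx' qy' q' r' A' rz Az qz.
move=> Exy Eyy Exx Ess.
have El : lambda = q' * (A' * qxx' + r' ^+ 2 / A' * qyy')
    - 3 * (A' * qx' ^+ 2 + r' ^+ 2 / A' * qy' ^+ 2) - (vx * qx' + vy * qy') / q'.
  by apply: (eq_of_proportional (c := - (q' ^+ 2 / A')) Ess); field; rewrite ?Az ?qz ?rz.
rewrite El in Exx Eyy Exy; split.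
- by apply: (eq_of_proportional (c := A' * q' ^+ 2) Exx); field; rewrite ?Az ?qz ?rz.
- by apply: (eq_of_proportional (c := r' ^+ 2 / A' * q' ^+ 2) Eyy); field; rewrite ?Az ?qz ?rz.
- by apply: (eq_of_proportional (c := 2 * r' ^+ 2 * q' ^+ 2) Exy); field; rewrite ?Az ?qz ?rz.
- exact: El.
Qed.

Lemma flat_soliton_sufficient (V : 'rV[R]_(2 + 2) -> 'rV[R]_(2 + 2)) lambda p :
  cover U p -> let z := lsubmx p in
  dA z = 0 -> dB z = 0 -> ddA z = 0 -> ddB z = 0 ->
  (forall l, partial i_s (fun x => V x 0 l) p = 0) ->
  (forall l, partial i_t (fun x => V x 0 l) p = 0) ->
  V p 0 i_s = 0 -> V p 0 i_t = 0 ->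
  (forall i, partial i (fun x => V x 0 i_s) p = 0) ->
  (forall i, partial i (fun x => V x 0 i_t) p = 0) ->
  flat_soliton_system V lambda p -> soliton_eq V lambda p.
Proof.
move=> Up z dA0 dB0 ddA0 ddB0 Vs Vt vs0 vt0 sV tV [dxx dyy dxy El].
have Uz : U z by [].
rewrite -/z in dxx dyy dxy El.
have [rz Az qz] := And3 (jr_neq0 J Uz) (jA_neq0 J Uz) (jq_neq0 J Uz).
have dyx : partial i_y (fun x => V x 0 i_x) p =
    (- (4 * q z * qxy z * A z * B z) - A z * partial i_x (fun x => V x 0 i_y) p) / B z.
  by apply: (mulfI (jB_neq0 Uz)); rewrite [RHS]mulrC divfK ?jB_neq0// -dxy addrK.
apply/soliton_entries => i j.
rewrite ricci_flat_conformal// lie_metric_entry// -/z sum4 !sV !tV vs0 vt0.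
rewrite /= -/z !metricE {sV tV vs0 vt0}.
move: i j; elim/ind4; elim/ind4.
all: rewrite ?Vs ?Vt ?dxx ?dyy ?dyx El /dmetric dA0 dB0 (jB_eq Uz) /tab /=.
all: move: (partial i_x (fun x => V x 0 i_y) p) (V p 0 i_x) (V p 0 i_y) => dxy' vx vy.
all: move: (qxx z) (qyy z) (qxy z) (qx z) (qy z) (q z) (r z) (A z) rz Az qz.
all: move=> qxx' qyy' qxy' qx' qy' q' r' A' rz Az qz.
all: by field; rewrite ?Az ?qz ?rz.
Qed.

End TorusGeometry.

(** * Reduction to invariant fields *)

Section AverageCombination.
Context {R : realType} {n : nat}.
Variables (v : 'rV[R]_n) (D : set 'rV[R]_n).
Hypothesis openD : open D.
Hypothesis transD : forall p (t : R), D p -> D (t *: v + p).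

(** Averaging along v preserves linear equations whose coefficients are constant
    along v. Three families are needed for the soliton equation: the components of
    the field and its derivatives in two directions. *)
Lemma average_combination m (a b c : 'I_m -> R)
    (f g h : 'I_m -> 'rV[R]_n -> R) (s : R) p :
  (forall l, smooth_on D (f l)) -> (forall l, smooth_on D (g l)) ->
  (forall l, smooth_on D (h l)) -> D p ->
  (forall t : R, \sum_l (a l * f l (t *: v + p) + b l * g l (t *: v + p)
                         + c l * h l (t *: v + p)) = s) ->
  \sum_l (a l * average v (f l) p + b l * average v (g l) p
          + c l * average v (h l) p) = s.
Proof.
move=> sf sg sh Dp fs; rewrite -[RHS]unit_mean_cst.
have ct (w : R) f' : smooth_on D f' -> continuous (fun t : R => w * f' (t *: v + p)).
  move=> sf' t; apply: cvgM; first exact: cvg_cst.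
  exact: (smooth_line_continuous transD sf' Dp).
have cl f' : smooth_on D f' -> continuous (fun t : R => f' (t *: v + p)).
  by move=> sf'; exact: (smooth_line_continuous transD sf' Dp).
have c2 l : continuous (fun t : R => a l * f l (t *: v + p) + b l * g l (t *: v + p)).
  by move=> t; apply: cvgD; exact: ct.
have c3 l : continuous (fun t : R => a l * f l (t *: v + p) + b l * g l (t *: v + p)
                                    + c l * h l (t *: v + p)).
  by move=> t; apply: cvgD; [exact: c2|exact: ct].
have -> : (fun=> s) = (fun t : R => \sum_l (a l * f l (t *: v + p)
    + b l * g l (t *: v + p) + c l * h l (t *: v + p))).
  by apply/funext => t; rewrite fs.
rewrite unit_mean_sum//; apply: eq_bigr => l _.
rewrite unit_meanD; [|exact: c2|exact: ct].
rewrite unit_meanD; [|exact: ct|exact: ct].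
by rewrite !unit_meanZ//; exact: cl.
Qed.

Lemma derive_average_commute w f p : smooth_on D f -> D p ->
  (forall q, D q -> 'D_w f q = 0) -> 'D_w (average v f) p = 0.
Proof.
move=> sf Dp dw.
have [dav pav] := average_differentiable openD transD sf Dp.
rewrite derive_partial//.
have := @average_combination n (fun i => w 0 i) (fun=> 0) (fun=> 0)
  (fun i => partial i f) (fun=> cst 0) (fun=> cst 0) 0 p.
under eq_bigr do rewrite !mul0r !addr0 -pav.
apply=> // [i|i|i|t]; [exact: smooth_on_partial|exact: smooth_on_cst..|].
have Dt : D (t *: v + p) by exact: transD.
rewrite -[RHS](dw _ Dt) derive_partial; last exact: (smooth_on_differentiable sf).
by apply: eq_bigr => i _; rewrite !mul0r !addr0.
Qed.

End AverageCombination.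

Section InvariantField.
Context {R : realType} (U : set 'rV[R]_2).
Hypothesis openU : open U.
Implicit Types (V : 'rV[R]_(2 + 2) -> 'rV[R]_(2 + 2)) (w : 'rV[R]_2).

Definition fibre_vector w : 'rV[R]_(2 + 2) := row_mx 0 w.

Lemma lsubmx_fibre w (t : R) p : lsubmx (t *: fibre_vector w + p) = lsubmx p.
Proof. by rewrite linearD linearZ /= row_mxKl scaler0 add0r. Qed.

Lemma cover_fibre w p (t : R) : cover U p -> cover U (t *: fibre_vector w + p).
Proof. by rewrite /Defs.cover /= lsubmx_fibre. Qed.

Definition average_field w V p : 'rV[R]_(2 + 2) :=
  \row_l average (fibre_vector w) (fun x => V x 0 l) p.

Lemma average_fieldE w V l :
  (fun x => average_field w V x 0 l) = average (fibre_vector w) (fun x => V x 0 l).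
Proof. by apply/funext => x; rewrite mxE. Qed.

(** Along the fibre direction w the metric, its derivatives and its Ricci tensor
    are constant, so each entry of the soliton equation is a linear equation of the
    kind preserved by averaging. *)
Lemma average_field_soliton k (J : torus_jet U k) w V lambda :
  1 - k ^+ 2 != 0 ->
  (forall l, smooth_on (cover U) (fun x => V x 0 l)) ->
  (forall p, cover U p -> soliton_eq J V lambda p) ->
  forall p, cover U p -> soliton_eq J (average_field w V) lambda p.
Proof.
move=> k1 sV solV p Up; apply/soliton_entries => i j.
have oC := open_cover openU.
have tC := @cover_fibre w.
have sVi i' l : smooth_on (cover U) (partial i' (fun x => V x 0 l)).
  by apply: smooth_on_partial; exact: sV.
pose s := 2 * (lambda * metric J (lsubmx p) i j - ricci (metric J \o lsubmx) p i j).
suff E : lie_metric (average_field w V) (metric J \o lsubmx) p i j = s.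
  rewrite E /s mulrA mulVf ?mul1r ?pnatr_eq0//.
  by rewrite addrC subrK.
rewrite lie_metric_entry//.
have pE i' l : partial i' (fun x => average_field w V x 0 l) p =
    average (fibre_vector w) (partial i' (fun x => V x 0 l)) p.
  by rewrite average_fieldE; have [_ ->] := average_differentiable oC tC (sV l) Up.
under eq_bigr do rewrite mulrC !pE mxE mulrC.
have := @average_combination _ _ (fibre_vector w) (cover U) tC _
  (fun l => dmetric J l (lsubmx p) i j) (fun l => metric J (lsubmx p) l j)
  (fun l => metric J (lsubmx p) i l) (fun l x => V x 0 l)
  (fun l => partial i (fun x => V x 0 l)) (fun l => partial j (fun x => V x 0 l)) s p.
move=> <- //.
  by apply: eq_bigr => l _; rewrite mulrC.
move=> t; have Ut := tC p t Up.
have := iffLR (soliton_entries _ _ _ _ _) (solV _ Ut) i j.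
rewrite (ricci_metric J openU k1 _ _ Ut) (lie_metric_entry _ _ _ _ Ut) /s.
rewrite (ricci_metric J openU k1 _ _ Up) /= !lsubmx_fibre.
move=> <-; rewrite addrAC subrr add0r mulrA divff ?pnatr_eq0// mul1r.
by apply: eq_bigr => l _; rewrite [dmetric _ _ _ _ _ * _]mulrC.
Qed.

Lemma derive_fibre_vector (f : 'rV[R]_(2 + 2) -> R) w p : differentiable f p ->
  'D_(fibre_vector w) f p = \sum_i w 0 i * partial (rshift 2 i) f p.
Proof.
move=> df; rewrite derive_partial// big_split_ord /= big1 ?add0r => [|i _].
  by apply: eq_bigr => i _; rewrite row_mxEr.
by rewrite row_mxEl mxE mul0r.
Qed.

(** The rows of b span the fibre directions. *)
Lemma fibre_partials_eq0 (b : 'M[R]_2) (f : 'rV[R]_(2 + 2) -> R) p :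
  b \in unitmx -> differentiable f p ->
  (forall a, 'D_(fibre_vector (row a b)) f p = 0) ->
  forall i, partial (rshift 2 i) f p = 0.
Proof.
move=> ub df db i; pose c := \col_i partial (rshift 2 i) f p.
have bc : b *m c = 0.
  apply/colP => a; rewrite !mxE -[RHS](db a) derive_fibre_vector//.
  by apply: eq_bigr => j _; rewrite !mxE.
by have := mulKmx ub c; rewrite bc mulmx0 => /colP/(_ i); rewrite !mxE.
Qed.

(** The field is averaged along one vector of a lattice basis and then along the
    other. The second average is invariant along its own direction because the first
    one is still periodic, and it stays invariant along the first direction
    because averaging commutes with derivatives. *)
Lemma invariant_soliton_field k (J : torus_jet U k) Gamma lambda :
  1 - k ^+ 2 != 0 -> is_lattice Gamma ->
  ricci_soliton U Gamma (metric J \o lsubmx) lambda ->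
  exists W : 'rV[R]_(2 + 2) -> 'rV[R]_(2 + 2),
  [/\ forall l, smooth_on (cover U) (fun x => W x 0 l),
    forall p l, cover U p -> partial i_s (fun x => W x 0 l) p = 0,
    forall p l, cover U p -> partial i_t (fun x => W x 0 l) p = 0 &
    forall p, cover U p -> soliton_eq J W lambda p].
Proof.
move=> k1 [b ub ->] [V [sV perV] solV].
have oC := open_cover openU.
pose w a := row a b.
have perw a p : cover U p -> V (fibre_vector (w a) + p) = V p.
  move=> Up; rewrite addrC perV//; exists (delta_mx 0 a).
  rewrite /w rowE; congr (_ *m _); apply/matrixP => i j.
  by rewrite !mxE; case: (_ && _).
pose W1 := average_field (w 1) V; pose W := average_field (w 0) W1.
have sW1 l : smooth_on (cover U) (fun x => W1 x 0 l).
  rewrite /W1 average_fieldE; apply: smooth_on_average => //; exact: cover_fibre.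
have sW l : smooth_on (cover U) (fun x => W x 0 l).
  rewrite /W average_fieldE; apply: smooth_on_average => //; exact: cover_fibre.
have fibre0 a p l : cover U p -> 'D_(fibre_vector (w a)) (fun x => W x 0 l) p = 0.
  move=> Up; rewrite /W average_fieldE.
  have [->|a1] : a = 0 \/ a = 1.
    by case: a => -[|[|//]] h; [left|right]; exact: val_inj.
  - apply: (derive_average_periodic oC (@cover_fibre _) (sW1 l) Up) => q Uq.
    rewrite /W1 !mxE; congr unit_mean; apply/funext => t.
    by rewrite addrCA perw//; exact: cover_fibre.
  - rewrite a1; apply: (derive_average_commute oC (@cover_fibre _) (sW1 l) Up) => q Uq.
    rewrite /W1 average_fieldE.
    by apply: (derive_average_periodic oC (@cover_fibre _) (sV l) Uq) => x /perw->.
have part0 i p l : cover U p -> partial (rshift 2 i) (fun x => W x 0 l) p = 0.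
  move=> Up; apply: (fibre_partials_eq0 ub) => [|a]; last exact: fibre0.
  exact: (smooth_on_differentiable (sW l) Up).
exists W; split=> // [p l Up|p l Up|].
- by rewrite (_ : i_s = rshift 2 0) ?part0//; exact: val_inj.
- by rewrite (_ : i_t = rshift 2 1) ?part0//; exact: val_inj.
- apply: average_field_soliton => //; exact: average_field_soliton.
Qed.

End InvariantField.

(** * The profiles and the conformal factor as a jet *)

Lemma partial_const_on {R : realType} n (U : set 'rV[R]_n) (f : 'rV[R]_n -> R) c i z :
  open U -> (forall z, U z -> f z = c) -> U z -> partial i f z = 0.
Proof.
move=> oU fc Uz; rewrite /partial -(derive_cst c z ('e_i)).
exact: (eq_on_derive _ oU fc Uz).
Qed.

Lemma ind2 (P : 'I_2 -> Prop) : P 0 -> P 1 -> forall i, P i.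
Proof.
move=> P0 P1 [[|[|//]] h].
- by rewrite (_ : Ordinal h = 0)//; exact: val_inj.
- by rewrite (_ : Ordinal h = 1)//; exact: val_inj.
Qed.

Section JetOfFunctions.
Context {R : realType}.

Lemma has_partial_sqrt n (i : 'I_n) (f : 'rV[R]_n -> R) z d :
  0 < f z -> has_partial i f z d ->
  has_partial i (fun z => Num.sqrt (f z)) z (d / (2 * Num.sqrt (f z))).
Proof.
move=> fz [df <-].
pose phi (t : R) := f (t *: 'e_i + z).
have phi0 : phi 0 = f z by rewrite /phi scale0r add0r.
have dphi : is_derive (0 : R) 1 phi (partial i f z).
  have := @is_derive_along _ _ f z 'e_i 0; rewrite scale0r add0r; exact.
have dsqrt : is_derive (phi 0) 1 Num.sqrt (2 * Num.sqrt (phi 0))^-1.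
  by apply: is_derive1_sqrt; rewrite phi0.
have [dc vc] := is_derive1_comp dsqrt dphi.
split; first by apply/derivable1P.
rewrite mulrC -phi0 -[RHS]vc; apply: eq_along_derive => t.
by rewrite /= /phi addr0 [t *: 1]mulr1.
Qed.

Variables (U : set 'rV[R]_2) (A B : R -> R) (q : 'rV[R]_2 -> R) (theta : R).
Hypothesis openU : open U.
Hypothesis smA : smooth_on U (fun z => A (z 0 0)).
Hypothesis smB : smooth_on U (fun z => B (z 0 1)).
Hypothesis smq : smooth_on U q.
Hypothesis posA : forall z, U z -> 0 < A (z 0 0).
Hypothesis posB : forall z, U z -> 0 < B (z 0 1).
Hypothesis neq : forall z, U z -> q z != 0.

Let fA (z : 'rV[R]_2) := A (z 0 0).
Let fB (z : 'rV[R]_2) := B (z 0 1).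
Let r z := Num.sqrt (fA z * fB z).

Let AB_gt0 z : U z -> 0 < fA z * fB z.
Proof. by move=> Uz; rewrite mulr_gt0 ?posA ?posB. Qed.

Let smooth_partial f i z : smooth_on U f -> U z -> has_partial i f z (partial i f z).
Proof. by move=> sf Uz; apply/has_partialP/(smooth_on_differentiable sf). Qed.

Let smooth_partial2 f i j z : smooth_on U f -> U z ->
  has_partial i (partial j f) z (partial i (partial j f) z).
Proof. by move=> sf; apply: smooth_partial; exact: smooth_on_partial. Qed.

Let partial_eq0 f i z : smooth_on U f -> U z -> partial i f z = 0 ->
  has_partial i f z 0.
Proof. by move=> sf Uz <-; exact: smooth_partial. Qed.

Let dAE : partial 0 fA = fun z => derive1 A (z 0 0).
Proof. by apply/funext => z; rewrite partial_coord. Qed.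

Let dBE : partial 1 fB = fun z => derive1 B (z 0 1).
Proof. by apply/funext => z; rewrite partial_coord. Qed.

Let r_partial i z a b : U z -> has_partial i fA z a -> has_partial i fB z b ->
  has_partial i r z ((fA z * b + fB z * a) / (2 * r z)).
Proof.
by move=> Uz ha hb; apply: has_partial_sqrt; [exact: AB_gt0|exact: has_partialM].
Qed.

Let sq z : U z -> r z ^+ 2 = fA z * fB z.
Proof. by move=> Uz; rewrite sqr_sqrtr// ltW// AB_gt0. Qed.

Let r_neq0 z : U z -> r z != 0.
Proof. by move=> Uz; rewrite gt_eqF// sqrtr_gt0 AB_gt0. Qed.

Let rx z : U z -> has_partial 0 r z (r z * partial 0 fA z / (2 * fA z)).
Proof.
move=> Uz; have B0 : has_partial 0 fB z 0.
  by apply: partial_eq0 => //; exact: partial_other_coord.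
have := r_partial Uz (smooth_partial 0 smA Uz) B0; congr has_partial.
have rz := r_neq0 Uz; have Az : fA z != 0 by rewrite gt_eqF// posA.
have -> : fB z = r z ^+ 2 / fA z by rewrite sq// mulrAC divff// mul1r.
by move: (r z) (fA z) (partial 0 _ z) rz Az => r' A' d' rz Az; field; rewrite rz Az.
Qed.

Let ry z : U z -> has_partial 1 r z (r z * partial 1 fB z / (2 * fB z)).
Proof.
move=> Uz; have A0 : has_partial 1 fA z 0.
  by apply: partial_eq0 => //; exact: partial_other_coord.
have := r_partial Uz A0 (smooth_partial 1 smB Uz); congr has_partial.
have rz := r_neq0 Uz; have Bz : fB z != 0 by rewrite gt_eqF// posB.
have -> : fA z = r z ^+ 2 / fB z by rewrite sq// mulfK.
by move: (r z) (fB z) (partial 1 _ z) rz Bz => r' A' d' rz Az; field; rewrite rz Az.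
Qed.

Definition jet_of_functions : torus_jet U (cos theta).
Proof.
refine (@TorusJet R U (cos theta) fA (partial 0 fA) (partial 0 (partial 0 fA))
  fB (partial 1 fB) (partial 1 (partial 1 fB)) r
  q (partial 0 q) (partial 1 q) (partial 0 (partial 0 q))
  (partial 0 (partial 1 q)) (partial 1 (partial 1 q))
  _ r_neq0 neq sq _ _ _ _ _ _ _ _ rx ry _ _ _ _ _ _) => z Uz.
- by rewrite gt_eqF// posA.
- exact: smooth_partial.
- by apply: partial_eq0 => //; exact: partial_other_coord.
- exact: smooth_partial2.
- apply: partial_eq0 => //; first exact: smooth_on_partial.
  by rewrite dAE; exact: partial_other_coord.
- by apply: partial_eq0 => //; exact: partial_other_coord.
- exact: smooth_partial.
- apply: partial_eq0 => //; first exact: smooth_on_partial.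
  by rewrite dBE; exact: partial_other_coord.
- exact: smooth_partial2.
- exact: smooth_partial.
- exact: smooth_partial.
- exact: smooth_partial2.
- by rewrite (schwarz 0 1 openU smq Uz); exact: smooth_partial2.
- exact: smooth_partial2.
- exact: smooth_partial2.
Defined.

Lemma torus_metric_jet :
  torus_metric theta A B q = metric jet_of_functions \o lsubmx.
Proof. by []. Qed.

(** * The equivalence *)

Let J := jet_of_functions.

Let second_eq0 (f : 'rV[R]_2 -> R) i z : (forall z, U z -> f z = 0) -> U z ->
  partial i f z = 0.
Proof. by move=> f0 Uz; exact: (partial_const_on _ openU f0 Uz). Qed.

Let cover_zero_section z : U z -> cover U (zero_section z).
Proof. by rewrite /Defs.cover /= zero_sectionK. Qed.

Section FromField.
Variables (W : 'rV[R]_(2 + 2) -> 'rV[R]_(2 + 2)) (lambda : R).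
Hypothesis k1 : 1 - cos theta ^+ 2 != 0.
Hypothesis sW : forall l, smooth_on (cover U) (fun x => W x 0 l).
Hypothesis Ws : forall p l, cover U p -> partial i_s (fun x => W x 0 l) p = 0.
Hypothesis Wt : forall p l, cover U p -> partial i_t (fun x => W x 0 l) p = 0.
Hypothesis solW : forall p, cover U p -> soliton_eq J W lambda p.

Lemma profile_derivatives_eq0 z : cos theta != 0 -> U z ->
  jdA J z = 0 /\ jdB J z = 0.
Proof.
move=> k0 Uz; have Cz := cover_zero_section Uz.
have := invariant_soliton_constant openU k1 Cz k0 _ _
  (fun l => Ws l Cz) (fun l => Wt l Cz) (solW Cz).
by rewrite /= zero_sectionK; apply; [exact: (posA Uz)|exact: (posB Uz)].
Qed.

Lemma profiles_constant : connected U -> cos theta != 0 ->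
  forall z z', U z -> U z' -> fA z = fA z' /\ fB z = fB z'.
Proof.
move=> cU k0 z z' Uz Uz'; have d0 x := @profile_derivatives_eq0 x k0; split.
- apply: (@locally_constant_on _ _ U fA openU cU _ _ _ _ Uz Uz').
    by move=> x Ux; exact: (smooth_on_differentiable smA Ux).
  by elim/ind2 => x Ux; [have [] := d0 x Ux|exact: partial_other_coord].
- apply: (@locally_constant_on _ _ U fB openU cU _ _ _ _ Uz Uz').
    by move=> x Ux; exact: (smooth_on_differentiable smB Ux).
  by elim/ind2 => x Ux; [exact: partial_other_coord|have [] := d0 x Ux].
Qed.

(** For constant profiles c = A or c = B, dividing by c lowers the index of the
    field with the flat metric. The added term is the derivative of q^2, whose Hessian
    2 q Hess q + 2 dq dq cancels the Hessian of q in the soliton equation. *)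
Definition potential (c : R) (i : 'I_2) : 'rV[R]_2 -> R :=
  fun z => c^-1 * W (zero_section z) 0 (lshift 2 i) + 2 * (q z * partial i q z).

Lemma smooth_potential c i : smooth_on U (potential c i).
Proof.
have -> : potential c i = cst c^-1 * ((fun x => W x 0 (lshift 2 i)) \o zero_section)
    + cst 2 * (q * partial i q) by [].
have sw := smooth_on_zero_section openU (sW (lshift 2 i)).
have sqq := smooth_onM openU smq (smooth_on_partial i smq).
apply: (smooth_onD openU); first exact: (smooth_onM openU (smooth_on_cst _) sw).
exact: (smooth_onM openU (smooth_on_cst _) sqq).
Qed.

Lemma partial_potential c i j z : U z -> partial j (potential c i) z =
  c^-1 * partial (lshift 2 j) (fun x => W x 0 (lshift 2 i)) (zero_section z)
  + 2 * (q z * partial j (partial i q) z + partial i q z * partial j q z).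
Proof.
move=> Uz; have sw := smooth_on_zero_section openU (sW (lshift 2 i)).
have := has_partialD
  (has_partialM (has_partial_cst j c^-1 z) (smooth_partial j sw Uz))
  (has_partialM (has_partial_cst j 2 z)
     (has_partialM (smooth_partial j smq Uz) (smooth_partial2 j i smq Uz))).
by move=> [_]; rewrite !mulr0 !addr0 partial_zero_section.
Qed.

Lemma system_of_field a b : a != 0 -> b != 0 ->
  (forall z, U z -> fA z = a) -> (forall z, U z -> fB z = b) ->
  soliton_system U A B q (potential a 0) (potential b 1) lambda.
Proof.
move=> a0 b0 Aa Bb z Uz; have Cz := cover_zero_section Uz.
have dA0 x : U x -> jdA J x = 0 by move=> Ux; exact: (partial_const_on _ openU Aa Ux).
have dB0 x : U x -> jdB J x = 0 by move=> Ux; exact: (partial_const_on _ openU Bb Ux).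
have := flat_soliton_necessary openU k1 Cz _ _ _ _
  (fun l => Ws l Cz) (fun l => Wt l Cz) (solW Cz).
rewrite /= zero_sectionK => /(_ (dA0 z Uz) (dB0 z Uz) (second_eq0 _ dA0 Uz)
  (second_eq0 _ dB0 Uz)).
rewrite /flat_soliton_system zero_sectionK /=.
have -> : i_x = lshift 2 0 by exact: val_inj.
have -> : i_y = lshift 2 1 by exact: val_inj.
rewrite -[A (z 0 0)]/(fA z) -[B (z 0 1)]/(fB z) (Aa z Uz) (Bb z Uz).
rewrite !partial_potential// (schwarz 1 0 openU smq Uz) /potential.
have := neq Uz.
move: (partial (lshift 2 0) (fun x => W x 0 (lshift 2 0)) _)
  (partial (lshift 2 1) (fun x => W x 0 (lshift 2 1)) _)
  (partial (lshift 2 1) (fun x => W x 0 (lshift 2 0)) _)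
  (partial (lshift 2 0) (fun x => W x 0 (lshift 2 1)) _) => dxx dyy dyx dxy.
move: (W _ 0 (lshift 2 0)) (W _ 0 (lshift 2 1)) => vx vy.
move: (partial 0 (partial 0 q) z) (partial 0 (partial 1 q) z)
  (partial 1 (partial 1 q) z) (partial 0 q z) (partial 1 q z) (q z).
move=> qxx qxy qyy qx qy q' q0 [-> -> Exy ->]; split.
- by apply: (eq_of_proportional (c := (a * b)^-1) Exy); field; rewrite ?a0 ?b0.
- by field.
- by field.
- by field; rewrite ?a0 ?b0 ?q0.
Qed.

End FromField.

(** The components of the field whose potentials are Sx and Sy, with nothing along
    the fibres. *)
Definition field_of_potentials (a b : R) (Sx Sy : 'rV[R]_2 -> R) (l : 'I_(2 + 2)) :
    'rV[R]_2 -> R :=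
  match nat_of_ord l with
  | 0 => fun z => a * (Sx z + - (2 * (q z * partial 0 q z)))
  | 1 => fun z => b * (Sy z + - (2 * (q z * partial 1 q z)))
  | _ => fun=> 0
  end.

Lemma smooth_potential_component (c : R) i (S : 'rV[R]_2 -> R) : smooth_on U S ->
  smooth_on U (fun z => c * (S z + - (2 * (q z * partial i q z)))).
Proof.
move=> sS; have smqi : smooth_on U (partial i q) by exact: smooth_on_partial.
have -> : (fun z => c * (S z + - (2 * (q z * partial i q z)))) =
    cst c * (S + cst (- 2) * (q * partial i q)).
  by apply/funext => z; rewrite !fctE mulNr.
have sqq := smooth_onM openU smq smqi.
apply: (smooth_onM openU (smooth_on_cst _)); apply: (smooth_onD openU sS).
exact: (smooth_onM openU (smooth_on_cst _) sqq).
Qed.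

Lemma partial_potential_component (c : R) i j (S : 'rV[R]_2 -> R) z :
  smooth_on U S -> U z ->
  partial j (fun z => c * (S z + - (2 * (q z * partial i q z)))) z =
  c * (partial j S z
       - 2 * (q z * partial j (partial i q) z + partial i q z * partial j q z)).
Proof.
move=> sS Uz; have := has_partialM (has_partial_cst j c z)
  (has_partialD (smooth_partial j sS Uz)
    (has_partialN (has_partialM (has_partial_cst j 2 z)
      (has_partialM (smooth_partial j smq Uz) (smooth_partial2 j i smq Uz))))).
by move=> [_]; rewrite !mulr0 !addr0.
Qed.

Lemma soliton_of_system Gamma a b Sx Sy lambda : 1 - cos theta ^+ 2 != 0 ->
  (forall z, U z -> fA z = a) -> (forall z, U z -> fB z = b) ->
  smooth_on U Sx -> smooth_on U Sy ->
  soliton_system U A B q Sx Sy lambda ->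
  ricci_soliton U Gamma (metric J \o lsubmx) lambda.
Proof.
move=> k1 Aa Bb sSx sSy sys; set v := field_of_potentials a b Sx Sy.
have smv l : smooth_on U (v l).
  elim/ind4: l; rewrite /v /field_of_potentials /=; try exact: smooth_on_cst;
    exact: smooth_potential_component.
pose V (p : 'rV[R]_(2 + 2)) : 'rV[R]_(2 + 2) := \row_l v l (lsubmx p).
have VE l : (fun x => V x 0 l) = v l \o lsubmx.
  by apply/funext => x; rewrite mxE.
exists V.
  split=> [l|p w Up _]; first by rewrite VE; exact: smooth_on_lift.
  by rewrite /V linearD /= row_mxKl addr0.
move=> p Up; set z := lsubmx p; have Uz : U z by [].
have dA0 x : U x -> jdA J x = 0 by move=> Ux; exact: (partial_const_on _ openU Aa Ux).
have dB0 x : U x -> jdB J x = 0 by move=> Ux; exact: (partial_const_on _ openU Bb Ux).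
have dV i l : partial i (fun x => V x 0 l) p = base_partial i (v l) z.
  by rewrite VE partial_lift.
have base0 i : base_partial i (fun=> 0 : R) z = 0.
  by elim/ind4: i => //=; exact: derive_cst.
apply: (@flat_soliton_sufficient _ _ _ J openU k1 V lambda p Up (dA0 z Uz) (dB0 z Uz)
  (second_eq0 _ dA0 Uz) (second_eq0 _ dB0 Uz)).
- by move=> l; rewrite dV.
- by move=> l; rewrite dV.
- by rewrite mxE.
- by rewrite mxE.
- by move=> i; rewrite dV base0.
- by move=> i; rewrite dV base0.
rewrite /flat_soliton_system !dV !mxE /base_partial /v /field_of_potentials /= -/z.
rewrite !partial_potential_component// (schwarz 1 0 openU smq Uz).
rewrite (Aa z Uz) (Bb z Uz).
have [] := sys z Uz; rewrite -[A _]/(fA z) -[B _]/(fB z) (Aa z Uz) (Bb z Uz).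
have := neq Uz.
move: (partial 0 Sx z) (partial 1 Sx z) (partial 0 Sy z) (partial 1 Sy z)
  (Sx z) (Sy z) => Sxx Sxy Syx Syy Sx' Sy'.
move: (partial 0 (partial 0 q) z) (partial 0 (partial 1 q) z)
  (partial 1 (partial 1 q) z) (partial 0 q z) (partial 1 q z) (q z).
move=> qxx qxy qyy qx qy q' q0 Exy -> -> ->; split.
- by ring.
- by ring.
- by apply: (eq_of_proportional (c := a * b) Exy); ring.
- by field.
Qed.

End JetOfFunctions.
Theorem theorem1p1 (R : realType) (U Gamma : set 'rV[R]_2)
    (A B : R -> R) (q : 'rV[R]_2 -> R) (theta lambda : R)
    (openU : open U) (connU : connected U) (neU : U !=set0)
    (latG : is_lattice Gamma)
    (smA : smooth_on U (fun z => A (z 0 0)))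
    (smB : smooth_on U (fun z => B (z 0 1)))
    (smq : smooth_on U q)
    (posA : forall z, U z -> 0 < A (z 0 0))
    (posB : forall z, U z -> 0 < B (z 0 1))
    (neq : forall z, U z -> q z != 0)
    (theta_gt0 : 0 < theta) (theta_lt : theta < pi / 2) :
  ricci_soliton U Gamma (torus_metric theta A B q) lambda <->
  [/\ exists a : R, forall z, U z -> A (z 0 0) = a,
      exists b : R, forall z, U z -> B (z 0 1) = b &
      exists Sx Sy : 'rV[R]_2 -> R,
        [/\ smooth_on U Sx, smooth_on U Sy &
            soliton_system U A B q Sx Sy lambda]].
Proof.
have k_gt0 : 0 < cos theta.
  apply: cos_gt0_pihalf; rewrite theta_lt andbT (lt_trans _ theta_gt0)//.
  by rewrite oppr_lt0 divr_gt0// pi_gt0.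
have k0 : cos theta != 0 by rewrite gt_eqF.
have k1 : 1 - cos theta ^+ 2 != 0.
  rewrite -sin2cos2 expf_neq0// gt_eqF// sin_gt0_pi// theta_gt0 /=.
  by have := pi_gt0 R; move: theta_lt; lra.
rewrite (torus_metric_jet theta openU smA smB smq posA posB neq).
split=> [sol|[[a Aa] [b Bb] [Sx [Sy [sSx sSy sys]]]]]; last first.
  exact: (soliton_of_system _ _ _ _ _ _ _ Gamma k1 Aa Bb sSx sSy sys).
have [W [sW Ws Wt solW]] := invariant_soliton_field openU k1 latG sol.
have [z0 Uz0] := neU.
have AB z (Uz : U z) := profiles_constant k1 Ws Wt solW connU k0 Uz Uz0.
split; [by exists (A (z0 0 0)) => z /AB[]|by exists (B (z0 0 1)) => z /AB[]|].
exists (potential q W (A (z0 0 0)) 0), (potential q W (B (z0 0 1)) 1); split.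
- exact: smooth_potential.
- exact: smooth_potential.
- apply: (system_of_field k1 sW Ws Wt solW).
  + by rewrite gt_eqF// posA.
  + by rewrite gt_eqF// posB.
  + by move=> z /AB[].
  + by move=> z /AB[].
Qed.
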